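(* Let $K$ be a field with $\operatorname{char}(K)=0$, let $A_1(K)=K\langle x,y \mid yx-xy=1\rangle$, and let $\alpha$ be the exchange involution of $A_1(K)$. Let $f$ be any $\alpha$-endomorphism of $A_1(K)$. Then $f$ is an $\alpha$-automorphism, and there exist $n\in\mathbb{N}_0$ and $a,b,c_0,\dots,c_n\in K$ with $a^2-b^2=1$ such that $$f(x)=ax+by+\sum_{j=0}^n c_j(x-y)^{2j}\quad\text{and}\quad f(y)=ay+bx+\sum_{j=0}^n c_j(x-y)^{2j}.$$
   Context: $A_1(K)=K\langle x,y \mid yx-xy=1\rangle$ is the first Weyl algebra: the unital associative $K$-algebra generated by $x,y$ subject to $yx-xy=1$. The exchange involution $\alpha:A_1(K)\to A_1(K)$ is the $K$-linear antihomomorphism ($\alpha(ab)=\alpha(b)\alpha(a)$) with $\alpha(x)=y$, $\alpha(y)=x$. An $\alpha$-endomorphism of $A_1(K)$ is a ($K$-algebra) endomorphism $f$ of $A_1(K)$ such that $f(\alpha(w))=\alpha(f(w))$ for every $w\in A_1(K)$. An $\alpha$-automorphism is an $\alpha$-endomorphism that is an automorphism. $\mathbb{N}_0$ denotes the non-negative integers. *)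

(* Defs.v *)
From HB Require Import structures.
From mathcomp Require Import all_boot all_algebra.
From mathcomp Require Import boolp.
From mathcomp Require Import finmap monalg.

Set Implicit Arguments.
Unset Strict Implicit.
Unset Printing Implicit Defensive.

Import GRing.Theory.
Local Open Scope ring_scope.
Local Open Scope quotient_scope.

(* The free algebra K<x, y>, as the monoid algebra of the free monoid on two
   letters: [false] is the letter x and [true] is the letter y. *)
Notation free_xy K := {malg K[fmonom bool]}.

(* Some definitions are locked so that unification does not unfold them. *)
HB.lock Definition free_x (K : fieldType) : free_xy K := << fmu false >>.
HB.lock Definition free_y (K : fieldType) : free_xy K := << fmu true >>.

(* The two-sided ideal generated by yx - xy - 1. *)
Inductive weyl_ideal_Prop (K : fieldType) : free_xy K -> Prop :=
| WeylRel :
    weyl_ideal_Prop (free_y K * free_x K - free_x K * free_y K - 1)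
| WeylIdeal0 : weyl_ideal_Prop 0
| WeylIdealB p q :
    weyl_ideal_Prop p -> weyl_ideal_Prop q -> weyl_ideal_Prop (p - q)
| WeylIdealMl r p : weyl_ideal_Prop p -> weyl_ideal_Prop (r * p)
| WeylIdealMr r p : weyl_ideal_Prop p -> weyl_ideal_Prop (p * r).

Definition weyl_ideal (K : fieldType) : {pred free_xy K} :=
  fun p => `[< weyl_ideal_Prop p >].

Section FreeAlgebra.
Variable K : fieldType.
Implicit Types (p q r : free_xy K) (c : K) (m : fmonom bool).

Lemma free_constC c p : c%:MP * p = p * c%:MP :> free_xy K.
Proof.
rewrite malgM_def fgmulUg malgM_def fgmulgU; apply: eq_bigr => m _.
by rewrite mul1m mulm1 mulrC.
Qed.

Lemma free_scalerAr c p q : c *: (p * q) = p * (c *: q).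
Proof.
have <- := mul_malgC c (p * q); have <- := mul_malgC c q.
by rewrite mulrA free_constC mulrA.
Qed.

Lemma weyl_ideal_zmod_closed : zmod_closed (@weyl_ideal K).
Proof.
split; first exact/asboolP/WeylIdeal0.
by move=> p q /asboolP Ip /asboolP Iq; apply/asboolP/WeylIdealB.
Qed.

HB.instance Definition _ :=
  GRing.isZmodClosed.Build (free_xy K) (@weyl_ideal K) weyl_ideal_zmod_closed.

Lemma weyl_idealMl r p : p \in @weyl_ideal K -> r * p \in @weyl_ideal K.
Proof. by move=> /asboolP Ip; apply/asboolP/WeylIdealMl. Qed.

Lemma weyl_idealMr r p : p \in @weyl_ideal K -> p * r \in @weyl_ideal K.
Proof. by move=> /asboolP Ip; apply/asboolP/WeylIdealMr. Qed.

Lemma weyl_idealZ c p : p \in @weyl_ideal K -> c *: p \in @weyl_ideal K.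
Proof. by rewrite -mul_malgC; exact: weyl_idealMl. Qed.

(* The ideal is proper: K<x, y> acts on K[X], x by multiplication by X and y
   by differentiation, and this action kills the ideal but not 1. *)
Let letter (b : bool) (u : {poly K}) : {poly K} := if b then u^`() else 'X * u.
Let word (m : fmonom bool) (u : {poly K}) : {poly K} := foldr letter u m.
Let act p (u : {poly K}) : {poly K} := \sum_(m <- msupp p) p@_m *: word m u.

Let wordB m : {morph word m : u v / u - v}.
Proof.
move=> u v; rewrite /word; elim: (fmonom_val m) => //= b s ->.
by case: b; rewrite /= ?derivB ?mulrBr.
Qed.

Let wordZ m c : {morph word m : u / c *: u}.
Proof.
move=> u; rewrite /word; elim: (fmonom_val m) => //= b s ->.
by case: b; rewrite /= ?derivZ ?scalerAr.
Qed.

Let actE p u : act p u = mmap polyC (fun m => word m u) p.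
Proof. by rewrite /act mmapE; apply: eq_bigr => m _; rewrite mul_polyC. Qed.

Let actB p q u : act (p - q) u = act p u - act q u.
Proof. by rewrite !actE mmapB. Qed.

Let act_sum (I : Type) (s : seq I) (F : I -> free_xy K) u :
  act (\sum_(i <- s) F i) u = \sum_(i <- s) act (F i) u.
Proof. by rewrite !actE raddf_sum; apply: eq_bigr => i _; rewrite actE. Qed.

Let actU c m u : act << c *g m >> u = c *: word m u.
Proof. by rewrite actE mmapU mul_polyC. Qed.

Let word_sum m (I : Type) (s : seq I) (F : I -> {poly K}) :
  word m (\sum_(i <- s) F i) = \sum_(i <- s) word m (F i).
Proof.
have word0 : word m 0 = 0 by rewrite -[X in word m X](subrr 0) wordB subrr.
have wordN u : word m (- u) = - word m u by rewrite -sub0r wordB word0 sub0r.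
have wordD : {morph word m : u v / u + v}.
  by move=> u v; rewrite -{1}[v]opprK wordB wordN opprK.
exact: (big_morph _ wordD word0).
Qed.

Let actM p q u : act (p * q) u = act p (act q u).
Proof.
rewrite malgME act_sum [RHS]/act; apply: eq_bigr => m _.
rewrite act_sum word_sum scaler_sumr; apply: eq_bigr => m' _.
rewrite actU wordZ scalerA; congr (_ *: _).
by rewrite /word fmM foldr_cat.
Qed.

Let act1 u : act 1 u = u.
Proof. by rewrite [act _ _]actU scale1r /word fm1. Qed.

Let act_ideal p : weyl_ideal_Prop p -> forall u, act p u = 0.
Proof.
have act0 u : act 0 u = 0 by rewrite actE mmap0.
have actr0 r : act r 0 = 0.
  rewrite /act big1 // => m _.
  by rewrite -[X in word m X](subrr 0) wordB subrr scaler0.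
elim=> [|//|{}p q _ IHp _ IHq|r {}p _ IHp|r {}p _ IHp] u.
- have yx : act (free_y K * free_x K) u = ('X * u)^`().
    by rewrite free_x.unlock free_y.unlock actM !actU !scale1r /word !fmU.
  have xy : act (free_x K * free_y K) u = 'X * u^`().
    by rewrite free_x.unlock free_y.unlock actM !actU !scale1r /word !fmU.
  have h s t v w : act s u = v -> act t u = w -> act (s - t - 1) u = v - w - u.
    by move=> <- <-; rewrite (actB (s - t) 1) (actB s t) act1.
  apply: etrans (h _ _ _ _ yx xy) _; rewrite derivM derivX.
  by rewrite mul1r addrK subrr.
- by rewrite actB IHp IHq subrr.
- by rewrite actM IHp actr0.
- by rewrite actM IHp.
Qed.

Lemma weyl_ideal1 : 1 \notin @weyl_ideal K.
Proof.
apply/negP => /asboolP/act_ideal/(_ 1)/eqP.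
by rewrite act1 oner_eq0.
Qed.

End FreeAlgebra.

(* The first Weyl algebra A_1(K) = K<x, y | yx - xy = 1>. *)
Definition weyl (K : fieldType) := Quotient.quot (@weyl_ideal K).

Definition weyl_pi (K : fieldType) (p : free_xy K) : weyl K := \pi_(weyl K) p.

HB.lock Definition weyl_one (K : fieldType) : weyl K := weyl_pi 1.
HB.lock Definition weyl_mul (K : fieldType) (a b : weyl K) : weyl K :=
  weyl_pi (repr a * repr b).
HB.lock Definition weyl_scale (K : fieldType) (c : K) (a : weyl K) : weyl K :=
  weyl_pi (c *: repr a).

HB.lock Definition weyl_x (K : fieldType) : weyl K := weyl_pi (free_x K).
HB.lock Definition weyl_y (K : fieldType) : weyl K := weyl_pi (free_y K).

Section WeylAlgebra.
Variable K : fieldType.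
Local Notation A := (weyl K).
Implicit Types (p q : free_xy K) (c : K) (a b : A).

HB.instance Definition _ := GRing.Zmodule.on A.

Lemma weyl_piP p q : (weyl_pi p = weyl_pi q) <-> (p - q \in @weyl_ideal K).
Proof. by rewrite Quotient.idealrBE; split=> [/eqP|/eqP]. Qed.

Lemma weyl_reprK a : weyl_pi (repr a) = a.
Proof. exact: reprK. Qed.

Lemma weyl_repr_pi p : repr (weyl_pi p) - p \in @weyl_ideal K.
Proof. by apply/weyl_piP; rewrite weyl_reprK. Qed.

Lemma weyl_piD : {morph @weyl_pi K : p q / p + q}.
Proof. by move=> p q; rewrite /weyl_pi !piE. Qed.

Lemma weyl_pi_mul p q : weyl_mul (weyl_pi p) (weyl_pi q) = weyl_pi (p * q).
Proof.
rewrite weyl_mul.unlock; apply/weyl_piP; set p' := repr _; set q' := repr _.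
have -> : p' * q' - p * q = p' * (q' - q) + (p' - p) * q.
  by rewrite mulrBr mulrBl addrA subrK.
by apply: rpredD; [apply: weyl_idealMl | apply: weyl_idealMr];
  apply: weyl_repr_pi.
Qed.

Lemma weyl_pi_scale c p : weyl_scale c (weyl_pi p) = weyl_pi (c *: p).
Proof.
rewrite weyl_scale.unlock; apply/weyl_piP; rewrite -scalerBr.
exact/weyl_idealZ/weyl_repr_pi.
Qed.

Lemma weyl_pi_one : weyl_pi 1 = weyl_one K.
Proof. by rewrite weyl_one.unlock. Qed.

Lemma weyl_mulA : associative (@weyl_mul K).
Proof.
move=> a b c; rewrite -[a]weyl_reprK -[b]weyl_reprK -[c]weyl_reprK.
by rewrite !weyl_pi_mul mulrA.
Qed.

Lemma weyl_mul1 : left_id (weyl_one K) (@weyl_mul K).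
Proof. by move=> a; rewrite -[a]weyl_reprK -weyl_pi_one weyl_pi_mul mul1r. Qed.

Lemma weyl_mulr1 : right_id (weyl_one K) (@weyl_mul K).
Proof. by move=> a; rewrite -[a]weyl_reprK -weyl_pi_one weyl_pi_mul mulr1. Qed.

Lemma weyl_mulDl : left_distributive (@weyl_mul K) +%R.
Proof.
move=> a b c; rewrite -[a]weyl_reprK -[b]weyl_reprK -[c]weyl_reprK.
by rewrite -weyl_piD !weyl_pi_mul mulrDl weyl_piD.
Qed.

Lemma weyl_mulDr : right_distributive (@weyl_mul K) +%R.
Proof.
move=> a b c; rewrite -[a]weyl_reprK -[b]weyl_reprK -[c]weyl_reprK.
by rewrite -weyl_piD !weyl_pi_mul mulrDr weyl_piD.
Qed.

Lemma weyl_one_neq0 : weyl_one K != 0.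
Proof.
rewrite (_ : 0 = weyl_pi 0); last by rewrite /weyl_pi piE.
by rewrite -weyl_pi_one; apply/eqP => /weyl_piP; rewrite subr0; apply/negP/weyl_ideal1.
Qed.

HB.instance Definition _ := GRing.Zmodule_isNzRing.Build A
  weyl_mulA weyl_mul1 weyl_mulr1 weyl_mulDl weyl_mulDr weyl_one_neq0.

Lemma weyl_scaleA c d a :
  weyl_scale c (weyl_scale d a) = weyl_scale (c * d) a.
Proof. by rewrite -[a]weyl_reprK !weyl_pi_scale scalerA. Qed.

Lemma weyl_scale1 : left_id 1 (@weyl_scale K).
Proof. by move=> a; rewrite -[a]weyl_reprK weyl_pi_scale scale1r. Qed.

Lemma weyl_scaleDr : right_distributive (@weyl_scale K) +%R.
Proof.
move=> c a b; rewrite -[a]weyl_reprK -[b]weyl_reprK.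
by rewrite -weyl_piD !weyl_pi_scale scalerDr weyl_piD.
Qed.

Lemma weyl_scaleDl a : {morph (@weyl_scale K)^~ a : c d / c + d}.
Proof.
move=> c d; rewrite -[a]weyl_reprK.
by rewrite !weyl_pi_scale scalerDl weyl_piD.
Qed.

HB.instance Definition _ := GRing.Zmodule_isLmodule.Build K A
  weyl_scaleA weyl_scale1 weyl_scaleDr weyl_scaleDl.

Lemma weyl_piM : {morph @weyl_pi K : p q / p * q}.
Proof. by move=> p q; exact/esym/weyl_pi_mul. Qed.

Lemma weyl_piZ c : {morph @weyl_pi K : p / c *: p}.
Proof. by move=> p; exact/esym/weyl_pi_scale. Qed.

Lemma weyl_scalerAl c a b : c *: (a * b) = (c *: a) * b.
Proof.
rewrite -[a]weyl_reprK -[b]weyl_reprK -weyl_piM -!weyl_piZ -weyl_piM.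
by rewrite scalerAl.
Qed.

HB.instance Definition _ := GRing.Lmodule_isLalgebra.Build K A weyl_scalerAl.

Lemma weyl_scalerAr c a b : c *: (a * b) = a * (c *: b).
Proof.
rewrite -[a]weyl_reprK -[b]weyl_reprK -weyl_piM -!weyl_piZ -weyl_piM.
by rewrite free_scalerAr.
Qed.

HB.instance Definition _ := GRing.Lalgebra_isAlgebra.Build K A weyl_scalerAr.

Lemma weyl_pi1 : weyl_pi 1 = 1.
Proof. exact: weyl_pi_one. Qed.

Lemma weyl_piB : {morph @weyl_pi K : p q / p - q}.
Proof. by move=> p q; rewrite /weyl_pi !piE. Qed.

Lemma weyl_relation : weyl_y K * weyl_x K - weyl_x K * weyl_y K = 1.
Proof.
rewrite weyl_x.unlock weyl_y.unlock -!weyl_piM -weyl_piB -weyl_pi1; apply/weyl_piP.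
exact/asboolP/WeylRel.
Qed.

End WeylAlgebra.

(* Reversing words and swapping the two letters is the linear antihomomorphism
   of K<x, y> exchanging x and y; it preserves the ideal of A_1(K). *)
Definition free_exchange (K : fieldType) (p : free_xy K) : free_xy K :=
  \sum_(m <- msupp p) << p@_m *g FMonom (rev (map negb m)) >>.

HB.lock Definition exchange (K : fieldType) (w : weyl K) : weyl K :=
  weyl_pi (free_exchange (repr w)).

Section Exchange.
Variable K : fieldType.
Implicit Types (p q : free_xy K) (c : K) (v w : weyl K).

Let wordC (m : fmonom bool) : fmonom bool := FMonom (rev (map negb m)).
Let fexch := @free_exchange K.

Let fexchE p : fexch p = mmap (@malgC _ K) (fun m => << wordC m >>) p.
Proof.
rewrite mmapE; apply: eq_bigr => m _.
by rewrite [RHS]malgM_def fgmulUU mulr1 mul1m.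
Qed.

Let fexchB p q : fexch (p - q) = fexch p - fexch q.
Proof. by rewrite !fexchE mmapB. Qed.

Let fexchD p q : fexch (p + q) = fexch p + fexch q.
Proof. by rewrite !fexchE mmapD. Qed.

Let fexch_sum (I : Type) (s : seq I) (F : I -> free_xy K) :
  fexch (\sum_(i <- s) F i) = \sum_(i <- s) fexch (F i).
Proof. by rewrite !fexchE raddf_sum; apply: eq_bigr => i _; rewrite fexchE. Qed.

Let fexchU c m : fexch << c *g m >> = << c *g wordC m >>.
Proof. by rewrite fexchE mmapU [LHS]malgM_def fgmulUU mulr1 mul1m. Qed.

Let wordCM m m' : wordC (mmul m m') = mmul (wordC m') (wordC m).
Proof. by rewrite /wordC fmM map_cat rev_cat [RHS]fmmulE. Qed.

Let fexchM p q : fexch (p * q) = fexch q * fexch p.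
Proof.
rewrite malgME fexch_sum [in RHS]/fexch /free_exchange mulr_sumr.
apply: eq_bigr => m _; rewrite fexch_sum mulr_suml; apply: eq_bigr => m' _.
by rewrite fexchU wordCM [RHS]malgM_def fgmulUU mulrC.
Qed.

Let fexch1 : fexch 1 = 1.
Proof.
rewrite [LHS]fexchU; congr << _ >>.
by apply: val_inj; rewrite /= fm1.
Qed.

Let fexchx : fexch (free_x K) = free_y K.
Proof.
by rewrite free_x.unlock free_y.unlock [LHS]fexchU /wordC fmU [in RHS]fmuE.
Qed.

Let fexchy : fexch (free_y K) = free_x K.
Proof.
by rewrite free_x.unlock free_y.unlock [LHS]fexchU /wordC fmU [in RHS]fmuE.
Qed.

Let fexchZ c p : fexch (c *: p) = c *: fexch p.
Proof.
rewrite -[in LHS]mul_malgC -[RHS]mul_malgC fexchM fexchU.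
have -> : wordC mone = mone by apply: val_inj; rewrite /= fm1.
exact/esym/free_constC.
Qed.

Let fexch_ideal p : p \in @weyl_ideal K -> fexch p \in @weyl_ideal K.
Proof.
move=> /asboolP; elim=> [||{}p q _ IHp _ IHq|r {}p _ IHp|r {}p _ IHp].
- have yx : fexch (free_y K * free_x K) = free_y K * free_x K.
    by apply: etrans (fexchM _ _) _; congr (_ * _).
  have xy : fexch (free_x K * free_y K) = free_x K * free_y K.
    by apply: etrans (fexchM _ _) _; congr (_ * _).
  have h r s t u : fexch r = s -> fexch t = u -> fexch (r - t - 1) = s - u - 1.
    by move=> <- <-; rewrite (fexchB (r - t) 1) (fexchB r t) fexch1.
  have -> := h _ _ _ _ yx xy; exact/asboolP/WeylRel.
- by rewrite fexchE mmap0 rpred0.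
- by have -> := fexchB p q; exact: (rpredB IHp IHq).
- by rewrite fexchM weyl_idealMr.
- by rewrite fexchM weyl_idealMl.
Qed.

Lemma exchange_pi p : exchange (weyl_pi p) = weyl_pi (free_exchange p).
Proof.
rewrite exchange.unlock; apply/weyl_piP; rewrite -fexchB.
exact/fexch_ideal/weyl_repr_pi.
Qed.

Lemma exchange_linear c v w :
  exchange (c *: v + w) = c *: exchange v + exchange w.
Proof.
rewrite -[v]weyl_reprK -[w]weyl_reprK -weyl_piZ -weyl_piD !exchange_pi.
by rewrite -/fexch fexchD fexchZ weyl_piD weyl_piZ.
Qed.

Lemma exchangeM v w : exchange (v * w) = exchange w * exchange v.
Proof.
rewrite -[v]weyl_reprK -[w]weyl_reprK -weyl_piM !exchange_pi.
by rewrite -/fexch fexchM weyl_piM.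
Qed.

Lemma exchange1 : exchange (1 : weyl K) = 1.
Proof. by rewrite -weyl_pi1 exchange_pi -/fexch fexch1. Qed.

Lemma exchange_x : exchange (weyl_x K) = weyl_y K.
Proof. by rewrite weyl_x.unlock weyl_y.unlock exchange_pi -/fexch fexchx. Qed.

Lemma exchange_y : exchange (weyl_y K) = weyl_x K.
Proof. by rewrite weyl_x.unlock weyl_y.unlock exchange_pi -/fexch fexchy. Qed.

End Exchange.

Definition alpha_endomorphism (K : fieldType)
    (f : {lrmorphism weyl K -> weyl K}) : Prop :=
  forall w, f (exchange w) = exchange (f w).

Definition alpha_automorphism (K : fieldType)
    (f : {lrmorphism weyl K -> weyl K}) : Prop :=
  alpha_endomorphism f /\ bijective f.

(* Main.v *)
(* Put u = x + y and v = (y - x)/2, so that vu - uv = 1, alpha(u) = u and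
   alpha(v) = -v. An alpha-endomorphism is a pair U = f(u) symmetric, V = f(v) skew
   with VU - UV = 1, and everything follows once V has degree 0 in u: then V = c v
   and U = u/c + h(v) with h even.

   Suppose the degree of V in u is positive, and let z be the leading coefficient.
   The coefficients of U and V generate a ring R; for almost all primes p some prime
   ideal Q of R contains p but not z. Modulo p, the p-th powers of U and V are
   central (Cayley-Hamilton in a p x p matrix model), hence polynomials in u^p and
   v^p. Computing modulo p^2 shows that these commuting polynomials have Jacobian 1,
   and alpha makes them even and odd in v^p, respectively. For commuting variables
   this parity forces the odd one to have degree 0 in u^p: its restriction to
   v^p = 0 vanishes, so the even one is linear there, and the Newton polygons have
   no room for further edges. But z^p is a leading coefficient of V^p outside Q. *)

From HB Require Import structures.
Require Import Defs.
From mathcomp Require Import all_boot all_order all_algebra zify ring lra.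
From mathcomp Require Import boolp.
From mathcomp Require classical_sets finmap monalg.

Set Implicit Arguments.
Unset Strict Implicit.
Unset Printing Implicit Defensive.

Import GRing.Theory.
Local Open Scope ring_scope.

(** Several coefficient rings are in play. In K every prime is invertible, so reduction takes place
    over a finitely generated subring R, where [prime_avoidance] keeps the chosen leading
    coefficient non-nilpotent modulo almost all p. Centrality is computed in R/pR, because the
    bracket appears only after a division by p in R; that quotient may have zero divisors, so the
    matrix argument uses neither eigenvalues nor fields. The prime ideal Q enters when factors have
    to be cancelled. Elements that are central modulo p have commutator 0 modulo p, and the Jacobian
    is the next term: [G, H] = p! {G, H} modulo p^2, and changing G or H by multiples of p does not
    affect this. Normal ordering gives [V^p, U^p] = p! modulo p^2. Both sides carry the same p!, so
    one p cancels by regularity and (p-1)! by being outside Q. The supports in u^p and v^p are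
    bounded by the degrees of U and V, independently of p. Hence p can be taken larger than every
    integer factor that occurs in the Jacobian. *)

Lemma subr_morphE (V W : zmodType) (f : V -> W) : {morph f : x y / x - y} ->
  [/\ f 0 = 0, {morph f : x / - x}, {morph f : x y / x + y}
    & forall n, {morph f : x / x *+ n}].
Proof.
move=> fB; have f0 : f 0 = 0 by have := fB 0 0; rewrite !subrr.
have fN : {morph f : x / - x} by move=> x; rewrite -sub0r fB f0 sub0r.
have fD : {morph f : x y / x + y}.
  by move=> x y; rewrite -{1}[y]opprK fB fN opprK.
by split=> // n x; elim: n => [|n IH]; rewrite ?mulr0n // !mulrS fD IH.
Qed.

(** * Additive maps on bivariate polynomials *)

Section BivariateSum.
Variables (R : nzRingType) (Z : zmodType).
Implicit Types (P Q : {poly {poly R}}) (f : nat -> nat -> R -> Z).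

Definition bisum f P : Z := \sum_(i < size P) \sum_(j < size P`_i) f i j P`_i`_j.

Lemma bisum_widen f P n m :
    (forall i j, f i j 0 = 0) -> (size P <= n)%N ->
    (forall i, (size (P`_i)%R <= m)%N) ->
  bisum f P = \sum_(i < n) \sum_(j < m) f i j P`_i`_j.
Proof.
move=> f0 lePn lePm.
rewrite /bisum (big_ord_widen n (fun i => \sum_(j < size P`_i) f i j P`_i`_j) lePn).
rewrite big_mkcond /=; apply: eq_bigr => i _; case: ltnP => [_|leP].
  rewrite (big_ord_widen m (fun j => f i j P`_i`_j) (lePm i)) big_mkcond /=.
  by apply: eq_bigr => j _; case: ltnP => // /(nth_default 0) ->; rewrite f0.
by rewrite big1 // => j _; rewrite (nth_default _ leP) coef0 f0.
Qed.

Definition inner_bound P : nat := \max_(i < size P) size (P`_i)%R.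

Lemma inner_boundP P i : (size (P`_i)%R <= inner_bound P)%N.
Proof.
case: (ltnP i (size P)) => [lti|/(nth_default 0) ->]; last by rewrite size_poly0.
exact: (@leq_bigmax _ (fun i : 'I_(size P) => size P`_i) (Ordinal lti)).
Qed.

Lemma bisumB f :
  (forall i j, {morph f i j : a b / a - b}) -> {morph bisum f : P Q / P - Q}.
Proof.
move=> fB; have f0 i j : f i j 0 = 0 by have := fB i j 0 0; rewrite !subrr.
move=> P Q.
pose n := maxn (size P) (size Q); pose m := maxn (inner_bound P) (inner_bound Q).
have [leP leQ] : (size P <= n)%N /\ (size Q <= n)%N by rewrite leq_maxl leq_maxr.
have lePm i : (size (P`_i)%R <= m)%N.
  exact: leq_trans (inner_boundP _ _) (leq_maxl _ _).
have leQm i : (size (Q`_i)%R <= m)%N.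
  exact: leq_trans (inner_boundP _ _) (leq_maxr _ _).
rewrite !(@bisum_widen f _ n m) //.
- rewrite -sumrB; apply: eq_bigr => i _; rewrite -sumrB; apply: eq_bigr => j _.
  by rewrite !coefB fB.
- rewrite (leq_trans (size_polyD _ _)) // geq_max leP size_polyN; exact: leQ.
- move=> i; rewrite coefB (leq_trans (size_polyD _ _)) // geq_max lePm size_polyN.
  exact: leQm.
Qed.

(* The monomial [c u^i v^j]: the outer variable is u, the inner one v. *)
Definition bimon (c : R) i j : {poly {poly R}} := (c *: 'X^j)%:P * 'X^i.

Lemma coef_bimon c i j k l :
  (bimon c i j)`_k`_l = c *+ (k == i) *+ (l == j).
Proof.
rewrite coefMXn coefC; case: (ltngtP k i) => [_|lt_ik|->].
- by rewrite coef0 !mul0rn.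
- by rewrite subn_eq0 leqNgt lt_ik coef0 !mul0rn.
- by rewrite subn_eq0 ?leqnn ?lexx coefZ coefXn mulr1n mulr_natr.
Qed.

Lemma bisum_bimon f c i j :
  (forall i j, f i j 0 = 0) -> bisum f (bimon c i j) = f i j c.
Proof.
move=> f0; rewrite (@bisum_widen f _ i.+1 j.+1) //.
- rewrite (bigD1 ord_max) //= (bigD1 ord_max) //= !coef_bimon !eqxx /= big1; last first.
    move=> l; rewrite -val_eqE /= => /negPf nl.
    by rewrite coef_bimon eqxx nl.
  rewrite addr0 big1 ?addr0 // => k; rewrite -val_eqE /= => /negPf nk.
  by rewrite big1 // => l _; rewrite coef_bimon nk mul0rn.
- apply/leq_sizeP => k ltk; apply/polyP => l.
  by rewrite coef_bimon coef0 (gtn_eqF ltk) mul0rn.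
- by move=> k; apply/leq_sizeP => l ltl; rewrite coef_bimon (gtn_eqF ltl).
Qed.

Lemma bimon_sum P : P = \sum_(i < size P) \sum_(j < size P`_i) bimon P`_i`_j i j.
Proof.
apply/polyP => k; apply/polyP => l; rewrite coef_sum coef_sum.
rewrite -[RHS]/(\sum_(i < _) _).
under eq_bigr do rewrite coef_sum coef_sum.
case: (ltnP k (size P)) => [ltk|lek]; last first.
  rewrite (nth_default _ lek) coef0 big1 // => i _; rewrite big1 // => j _.
  by rewrite coef_bimon (gtn_eqF (leq_trans (ltn_ord i) lek)) mul0rn.
rewrite (bigD1 (Ordinal ltk)) //= [X in _ + X]big1 ?addr0; last first.
  move=> i; rewrite -val_eqE /= eq_sym => /negPf nk; rewrite big1 // => j _.
  by rewrite coef_bimon nk mul0rn.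
under eq_bigr do rewrite coef_bimon eqxx mulr1n.
case: (ltnP l (size (P`_k)%R)) => [ltl|lel]; last first.
  rewrite (nth_default _ lel) big1 // => i _.
  by rewrite (gtn_eqF (leq_trans (ltn_ord i) lel)).
rewrite (bigD1 (Ordinal ltl)) //= eqxx mulr1n big1 ?addr0 // => i.
by rewrite -val_eqE /= eq_sym => /negPf ->.
Qed.

End BivariateSum.

(** Only additivity is asked, because the maps compared later (evaluations, products, coefficients)
    land in groups without a common scalar action. Identities in the Weyl algebra thus reduce to
    single monomials. *)
Lemma bipoly_ind (R : nzRingType) (Z : zmodType) (f g : {poly {poly R}} -> Z) :
    {morph f : P Q / P - Q} -> {morph g : P Q / P - Q} ->
    (forall c i j, f (bimon c i j) = g (bimon c i j)) -> f =1 g.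
Proof.
move=> fB gB fg P.
have [f0 _ fD _] := subr_morphE fB; have [g0 _ gD _] := subr_morphE gB.
rewrite (bimon_sum P) !(big_morph f fD f0, big_morph g gD g0).
apply: eq_bigr => i _; rewrite !(big_morph f fD f0, big_morph g gD g0).
by apply: eq_bigr => j _; rewrite fg.
Qed.

(** * The Weyl algebra on normally ordered polynomials *)

Section Star.
Variable R : comNzRingType.
Local Notation M := {poly {poly R}}.
Implicit Types (P Q F : M) (c d : R).

(* Left multiplication by v on the normally ordered symbols: v u^i = u^i v + i u^(i-1). *)
Definition inner_op Q : M := Q^`() + 'X%:P * Q.

Lemma inner_opB : {morph inner_op : P Q / P - Q}.
Proof. by move=> P Q; rewrite /inner_op derivB mulrBr opprD addrACA. Qed.

Lemma mulC_bimon c d i j : c%:P%:P * bimon d i j = bimon (c * d) i j :> M.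
Proof. by rewrite /bimon mulrA -polyCM [c%:P * _]mul_polyC scalerA. Qed.

Lemma mulX_bimon c i j : 'X * bimon c i j = bimon c i.+1 j :> M.
Proof. by rewrite /bimon exprS !mulrA [_%:P * 'X]commr_polyX. Qed.

Lemma inner_op_bimon c i j :
  inner_op (bimon c i j) = bimon (c *+ i) i.-1 j + bimon c i j.+1.
Proof.
rewrite /inner_op /bimon; congr (_ + _).
  rewrite derivM derivC mul0r add0r derivXn mulrnAr -mulrnAl -polyCMn.
  by rewrite -scalerMnl.
by rewrite mulrA -polyCM -scalerAr -exprS.
Qed.

Section Eval.
Variables (Z : zmodType) (cs : R -> Z -> Z) (u v : Z -> Z).
Hypotheses (csBl : forall z, {morph cs^~ z : c d / c - d})
  (csB : forall c, {morph cs c : z w / z - w})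
  (csM : forall c d z, cs (c * d) z = cs c (cs d z))
  (uB : {morph u : z w / z - w}) (vB : {morph v : z w / z - w})
  (csu : forall c z, cs c (u z) = u (cs c z))
  (csv : forall c z, cs c (v z) = v (cs c z))
  (vu : forall z, v (u z) = u (v z) + z).

(** u and v act as operators on an additive group, u being applied last. When that group consists of
    the symbols themselves, this evaluation is the product [star]. *)
Definition opeval P z : Z :=
  bisum (fun i j c => cs c (iter i u (iter j v z))) P.

Let cs0 z : cs 0 z = 0. Proof. by have := csBl z 0 0; rewrite !subrr. Qed.

Lemma opeval_bimon c i j z :
  opeval (bimon c i j) z = cs c (iter i u (iter j v z)).
Proof. by rewrite /opeval bisum_bimon // => k l; apply: cs0. Qed.

Lemma opevalBl z : {morph opeval^~ z : P Q / P - Q}.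
Proof. by apply: bisumB => i j c d /=; rewrite csBl. Qed.

Lemma opeval_polyC c Q z : opeval (c%:P%:P * Q) z = cs c (opeval Q z).
Proof.
apply: (@bipoly_ind _ _ (fun Q => opeval (c%:P%:P * Q) z)
  (fun Q => cs c (opeval Q z))) => [A B|A B|d i j] /=.
- by rewrite mulrBr opevalBl.
- by rewrite opevalBl csB.
- by rewrite mulC_bimon !opeval_bimon csM.
Qed.

Lemma opeval_mulX Q z : opeval ('X * Q) z = u (opeval Q z).
Proof.
apply: (@bipoly_ind _ _ (fun Q => opeval ('X * Q) z)
  (fun Q => u (opeval Q z))) => [A B|A B|d i j] /=.
- by rewrite mulrBr opevalBl.
- by rewrite opevalBl uB.
- by rewrite mulX_bimon !opeval_bimon /= csu.
Qed.

Lemma vuX i z : v (iter i u z) = iter i u (v z) + iter i.-1 u z *+ i.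
Proof.
have [_ _ uD uMn] := subr_morphE uB.
elim: i => [|i IH]; first by rewrite mulr0n addr0.
rewrite /= vu IH uD uMn -addrA; congr (_ + _).
by case: i {IH} => [|i] /=; rewrite ?mulr0n ?add0r ?mulr1n // [RHS]mulrSr.
Qed.

Lemma opeval_inner Q z : opeval (inner_op Q) z = v (opeval Q z).
Proof.
apply: (@bipoly_ind _ _ (fun Q => opeval (inner_op Q) z)
  (fun Q => v (opeval Q z))) => [A B|A B|c i j] /=.
- by rewrite inner_opB opevalBl.
- by rewrite opevalBl vB.
- have [_ _ opevalD _] := subr_morphE (opevalBl z).
  have [_ _ _ csMn] := subr_morphE (csBl (iter i.-1 u (iter j v z))).
  rewrite inner_op_bimon opevalD !opeval_bimon csMn /= [LHS]addrC.
  have [_ _ csD csMr] := subr_morphE (csB c).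
  by rewrite -csv vuX csD csMr.
Qed.

End Eval.

Definition star P Q : M := opeval (fun c F => c%:P%:P * F) (fun F => 'X * F) inner_op P Q.

Lemma inner_opX (F : M) : inner_op ('X * F) = 'X * inner_op F + F.
Proof.
rewrite /inner_op derivM derivX mul1r mulrDr addrAC -addrA addrC; congr (_ + _).
by rewrite addrC mulrCA.
Qed.

Lemma inner_opZ c F : c%:P%:P * inner_op F = inner_op (c%:P%:P * F).
Proof. by rewrite /inner_op derivM derivC mul0r add0r mulrDr mulrCA. Qed.

Lemma starBl F : {morph star^~ F : P Q / P - Q}.
Proof. by apply: opevalBl => z c d /=; rewrite !polyCB mulrBl. Qed.

Lemma star_bimon c i j F :
  star (bimon c i j) F = c%:P%:P * ('X^i * iter j inner_op F).
Proof.
rewrite /star opeval_bimon; last by move=> z a b /=; rewrite !polyCB mulrBl.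
congr (_ * _); elim: i => [|i IH]; first by rewrite mul1r.
by rewrite iterS IH exprS mulrA.
Qed.

Section EvalStar.
Variables (Z : zmodType) (cs : R -> Z -> Z) (u v : Z -> Z).
Hypotheses (csBl : forall z, {morph cs^~ z : c d / c - d})
  (csB : forall c, {morph cs c : z w / z - w})
  (csM : forall c d z, cs (c * d) z = cs c (cs d z))
  (uB : {morph u : z w / z - w}) (vB : {morph v : z w / z - w})
  (csu : forall c z, cs c (u z) = u (cs c z))
  (csv : forall c z, cs c (v z) = v (cs c z))
  (vu : forall z, v (u z) = u (v z) + z).
Local Notation ev := (opeval cs u v).

(** Multiplying a symbol on the left by u or v is carried to applying the operator u or v. With [Z]
    the symbols this yields associativity of the product; with [Z] a ring, multiplicativity of
    substitution. *)
Lemma opeval_star P Q z : ev (star P Q) z = ev P (ev Q z).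
Proof.
apply: (@bipoly_ind _ _ (fun P => ev (star P Q) z)
  (fun P => ev P (ev Q z))) => [A B|A B|c i j] /=.
- by rewrite starBl opevalBl.
- by rewrite opevalBl.
- rewrite star_bimon opeval_polyC // opeval_bimon //; congr cs.
  elim: i => [|i IH]; last by rewrite exprS -mulrA opeval_mulX // IH.
  by rewrite mul1r; elim: j => //= j IH; rewrite opeval_inner // IH.
Qed.

End EvalStar.
End Star.

(* The first Weyl algebra over an arbitrary commutative ring: P stands for the
   normally ordered sum of the P`_i`_j u^i v^j, where vu - uv = 1. *)
Definition wpoly (R : comNzRingType) := {poly {poly R}}.

Section WpolyRing.
Variable R : comNzRingType.
Implicit Types (P Q F : wpoly R).

HB.instance Definition _ := GRing.Zmodule.on (wpoly R).

Definition wstar : wpoly R -> wpoly R -> wpoly R := @star R.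
Definition wone : wpoly R := bimon 1 0 0.

Lemma wstarA : associative wstar.
Proof.
move=> P Q F; apply/esym/opeval_star => //.
- by move=> z c d /=; rewrite !polyCB mulrBl.
- by move=> c z w /=; rewrite mulrBr.
- by move=> c d z /=; rewrite !polyCM mulrA.
- by move=> z w /=; rewrite mulrBr.
- exact: inner_opB.
- by move=> c z /=; rewrite mulrCA.
- exact: inner_opZ.
- exact: inner_opX.
Qed.

Lemma wstar1l : left_id wone wstar.
Proof. by move=> P; rewrite /wstar /wone star_bimon !mul1r. Qed.

Lemma iter_inner_one j : iter j (@inner_op R) wone = bimon 1 0 j.
Proof.
elim: j => //= j ->; rewrite inner_op_bimon mulr0n.
by rewrite {1}/bimon scale0r polyC0 mul0r add0r.
Qed.

Lemma wstar1r : right_id wone wstar.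
Proof.
move=> P; apply: (@bipoly_ind _ _ (fun P : wpoly R => wstar P wone) id) => //.
- exact: starBl.
move=> c i j; rewrite /wstar star_bimon iter_inner_one.
have -> : 'X^i * bimon 1 0 j = bimon 1 i j :> {poly {poly R}}.
  by elim: i => [|i IH]; rewrite ?mul1r // exprS -mulrA IH mulX_bimon.
by rewrite mulC_bimon mulr1.
Qed.

Lemma wstarDl : left_distributive wstar +%R.
Proof.
move=> P Q F; rewrite -{1}[Q]opprK /wstar starBl.
by have [_ -> _ _] := subr_morphE (starBl F); rewrite opprK.
Qed.

Lemma wstarDr : right_distributive wstar +%R.
Proof.
move=> P Q F; apply: (@bipoly_ind _ _ (fun P : wpoly R => wstar P (Q + F))
  (fun P : wpoly R => wstar P Q + wstar P F)) => [A B|A B|c i j] /=.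
- exact: starBl.
- by rewrite /wstar !starBl addrACA opprD.
rewrite /wstar !star_bimon -!mulrDr; congr (_ * (_ * _)).
elim: j => //= j ->.
by rewrite /inner_op derivD mulrDr addrACA.
Qed.

Lemma wone_neq0 : wone != 0.
Proof.
apply/eqP => /(congr1 (fun P : {poly {poly R}} => P`_0`_0)) /eqP.
by rewrite coef_bimon !coef0 oner_eq0.
Qed.

HB.instance Definition _ := GRing.Zmodule_isNzRing.Build (wpoly R)
  wstarA wstar1l wstar1r wstarDl wstarDr wone_neq0.

End WpolyRing.

(** * Normal ordering and evaluation homomorphisms *)

Lemma commX_normal (B : nzRingType) (u v : B) n :
  v * u - u * v = 1 -> v * u ^+ n = u ^+ n * v + u ^+ n.-1 *+ n.
Proof.
move=> vu1; elim: n => [|n IH]; first by rewrite mulr1 mul1r mulr0n addr0.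
have vu : v * u = u * v + 1 by rewrite -vu1 addrC subrK.
rewrite exprS mulrA vu mulrDl mul1r -mulrA IH mulrDr mulrA -addrA; congr (_ + _).
case: n {IH} => [|n] /=; first by rewrite mulr0n mulr0 add0r.
by rewrite mulrnAr -exprS -mulrSr.
Qed.

Section NormalOrder.
Variables (B : nzRingType) (u v : B).
Hypothesis vu1 : v * u - u * v = 1.

(** Replacing (u, v) by (v, -u) preserves the relation, which reduces this to [commX_normal]. *)
Lemma commX_normalr n : v ^+ n * u = u * v ^+ n + v ^+ n.-1 *+ n.
Proof.
have vu1' : - u * v - v * - u = 1 by rewrite mulNr mulrN opprK addrC.
have := commX_normal n vu1'; rewrite mulNr mulrN => e.
by rewrite -[v ^+ n.-1 *+ n](addNKr (v ^+ n * u)) -e addrC subrK.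
Qed.

(** The integer factor is k! C(m,k) C(n,k); its divisibility by p and p^2 drives all later
    commutator computations. For k > n the falling factorial vanishes, so the truncated exponent n -
    k does no harm. *)
Lemma normal_order m n :
  v ^+ m * u ^+ n
  = \sum_(k < m.+1) (u ^+ (n - k) * v ^+ (m - k)) *+ ('C(m, k) * n ^_ k).
Proof.
elim: m => [|m IH]; first by rewrite big_ord1 /= bin0 ffactn0 subn0 mul1r mulr1 mulr1n.
rewrite exprS -mulrA IH mulr_sumr.
under eq_bigr => k _ do rewrite mulrnAr mulrA (commX_normal _ vu1) mulrDl mulrnDl.
rewrite big_split /= [RHS]big_ord_recl /=.
under [X in _ = _ + X]eq_bigr => k _ do
  rewrite /bump /= add1n binS mulnDl mulrnDr subSS subnS.
rewrite big_split /= addrA; congr (_ + _); last first.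
  apply: eq_bigr => k _; rewrite -mulrnAl -mulrnA mulnCA ffactnSr.
  by rewrite mulrnAl [(n ^_ k * _)%N]mulnC.
rewrite big_ord_recl /= [in RHS]big_ord_recr /= (bin_small (ltnSn m)) mul0n mulr0n addr0.
rewrite !subn0 !bin0 -mulrA -exprS; congr (_ + _).
apply: eq_bigr => k _; rewrite /bump /= add1n -mulrA -exprS subnS.
by rewrite subnSK.
Qed.

End NormalOrder.

Section WpolyEval.
Variables (R : comNzRingType) (B : nzRingType) (phi : {rmorphism R -> B}).
Variables (u v : B).
Hypotheses (phiu : forall c, GRing.comm (phi c) u)
  (phiv : forall c, GRing.comm (phi c) v) (vu1 : v * u - u * v = 1).
Implicit Types (P Q : wpoly R).

Definition weval P : B := bisum (fun i j c => phi c * (u ^+ i * v ^+ j)) P.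

Lemma weval_bimon c i j : weval (bimon c i j) = phi c * (u ^+ i * v ^+ j).
Proof. by rewrite /weval bisum_bimon // => *; rewrite rmorph0 mul0r. Qed.

Lemma wevalB : {morph weval : P Q / P - Q}.
Proof. by apply: bisumB => i j c d /=; rewrite rmorphB mulrBl. Qed.

Lemma weval1 : weval 1 = 1.
Proof. by rewrite [LHS]weval_bimon rmorph1 !mul1r. Qed.

Lemma wevalM : {morph weval : P Q / P * Q}.
Proof.
move=> P Q.
pose ev := opeval (fun c z => phi c * z) (fun z : B => u * z) (fun z => v * z).
have csB z : {morph (fun c => phi c * z) : c d / c - d}.
  by move=> c d; rewrite rmorphB mulrBl.
have evE F z : ev F z = weval F * z.
  apply: (@bipoly_ind _ _ (ev^~ z) (fun F => weval F * z)) => [A C|A C|c i j] /=.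
  - exact: opevalBl.
  - by rewrite wevalB mulrBl.
  - rewrite /ev opeval_bimon // weval_bimon -!mulrA; congr (_ * _).
    elim: i => [|i IH]; last by rewrite exprS -mulrA -IH.
    by rewrite mul1r; elim: j => [|j IH]; rewrite ?mul1r // exprS -mulrA -IH.
rewrite -[LHS]mulr1 -[weval Q]mulr1 -!evE; apply: opeval_star => //.
- by move=> c z w /=; rewrite mulrBr.
- by move=> c d z /=; rewrite rmorphM mulrA.
- by move=> z w /=; rewrite mulrBr.
- by move=> z w /=; rewrite mulrBr.
- by move=> c z /=; rewrite !mulrA phiu.
- by move=> c z /=; rewrite !mulrA phiv.
- by move=> z /=; rewrite !mulrA -[v * u](subrK (u * v)) vu1 mulrDl mul1r addrC.
Qed.

Lemma wevalX n : {morph weval : P / P ^+ n}.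
Proof. by move=> P; elim: n => [|n IH]; rewrite ?weval1 // !exprS wevalM IH. Qed.

End WpolyEval.

(** * Coefficients and degrees of normally ordered elements *)

Section WpolyTheory.
Variable R : comNzRingType.
Local Notation M := {poly {poly R}}.
Local Notation W := (wpoly R).
Implicit Types (P Q : W) (c d : R).

Definition wcoef P i j : R := (P : M)`_i`_j.

Lemma wcoefP P Q : (forall i j, wcoef P i j = wcoef Q i j) -> P = Q.
Proof. by move=> eqPQ; apply/polyP => i; apply/polyP => j; apply: eqPQ. Qed.

Lemma wcoefB i j : {morph wcoef^~ i ^~ j : P Q / P - Q}.
Proof. by move=> P Q; rewrite /wcoef !coefB. Qed.

Lemma wcoefD i j : {morph wcoef^~ i ^~ j : P Q / P + Q}.
Proof. by move=> P Q; rewrite /wcoef !coefD. Qed.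

Lemma wcoef0 i j : wcoef 0 i j = 0.
Proof. by rewrite /wcoef !coef0. Qed.

Lemma wcoefMn n i j P : wcoef (P *+ n) i j = wcoef P i j *+ n.
Proof. by rewrite /wcoef !coefMn. Qed.

Lemma wcoef_sum (I : Type) (r : seq I) (p : pred I) (F : I -> W) i j :
  wcoef (\sum_(k <- r | p k) F k) i j = \sum_(k <- r | p k) wcoef (F k) i j.
Proof. exact: (big_morph _ (wcoefD i j) (wcoef0 i j)). Qed.

Definition wmon c i j : W := bimon c i j.
Definition wX : W := wmon 1 1 0.
Definition wL : W := wmon 1 0 1.

Lemma wcoef_mon c i j k l : wcoef (wmon c i j) k l = c *+ (k == i) *+ (l == j).
Proof. exact: coef_bimon. Qed.

Lemma wone_poly : (1 : W) = (1 : M).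
Proof. by rewrite [LHS](_ : _ = bimon 1 0 0) // /bimon mulr1 scale1r. Qed.

Lemma wpoly_sum P :
  P = \sum_(i < size (P : M)) \sum_(j < size (P : M)`_i) wmon (wcoef P i j) i j.
Proof. exact: bimon_sum. Qed.

Lemma wmonE c i j Q :
  wmon c i j * Q = c%:P%:P * ('X^i * iter j (@inner_op R) Q : M) :> M.
Proof. exact: star_bimon. Qed.

Lemma wmonB i j : {morph (fun c => wmon c i j) : c d / c - d}.
Proof.
move=> c d; apply: wcoefP => k l; rewrite wcoefB !wcoef_mon.
by rewrite -!mulrnA mulrnBl.
Qed.

Lemma iter_inner_wL j : iter j (@inner_op R) (1 : W) = wmon 1 0 j.
Proof. exact: iter_inner_one. Qed.

Lemma wmon_split c i j : wmon c i j = wmon c 0 0 * (wX ^+ i * wL ^+ j).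
Proof.
have L k : wL ^+ k = wmon 1 0 k.
  elim: k => [|k IH] //; rewrite exprS IH -iter_inner_wL.
  by rewrite [LHS]wmonE -iterS !mul1r -iter_inner_wL.
have X k : wX ^+ i * wmon 1 0 k = wmon 1 i k.
  elim: i => [|i IH]; first by rewrite mul1r.
  by rewrite exprS -mulrA IH [LHS]wmonE mul1r /= expr1 mulX_bimon.
by rewrite L X [RHS]wmonE mul1r /= mulC_bimon mulr1.
Qed.

Lemma wcoefCM c P i j : wcoef (wmon c 0 0 * P) i j = c * wcoef P i j.
Proof. by rewrite /wcoef wmonE mul1r coefCM coefCM. Qed.

Lemma wmonC c P : wmon c 0 0 * P = P * wmon c 0 0.
Proof.
apply: (@bipoly_ind _ _ (fun P : W => wmon c 0 0 * P) (fun P => P * wmon c 0 0)).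
- by move=> A C; rewrite -mulrBr.
- by move=> A C; rewrite -mulrBl.
move=> d i j; rewrite [LHS]wmonE [RHS]wmonE /= mul1r.
have -> : iter j (@inner_op R) (wmon c 0 0) = bimon c 0 j.
  have -> : wmon c 0 0 = c%:P%:P * (1 : W) :> M by rewrite [RHS]mulC_bimon mulr1.
  rewrite -[X in bimon X 0 j](mulr1 c) -mulC_bimon -[bimon 1 0 j]iter_inner_wL.
  by elim: j => //= j ->; rewrite -inner_opZ.
have mulXi (e : R) : 'X^i * bimon e 0 j = bimon e i j :> M.
  by elim: i => [|i IH]; rewrite ?mul1r // exprS -mulrA IH mulX_bimon.
by rewrite !mulXi !mulC_bimon mulrC.
Qed.

Lemma wmonM c d : wmon c 0 0 * wmon d 0 0 = wmon (c * d) 0 0.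
Proof. by rewrite [LHS]wmonE mul1r /= mulC_bimon. Qed.

Lemma wLX : wL * wX - wX * wL = 1.
Proof.
have -> : wL * wX = 1 + wmon 1 1 1.
  by rewrite [LHS]wmonE !mul1r /= inner_op_bimon mulr1n.
have -> : wX * wL = wmon 1 1 1 by rewrite [LHS]wmonE mul1r mulX_bimon.
by rewrite addrK.
Qed.

Lemma wmonXL i j : wmon 1 i j = wX ^+ i * wL ^+ j.
Proof. by rewrite [LHS]wmon_split [LHS]mul1r. Qed.

(** Bracketing with u differentiates the symbol with respect to v. *)
Lemma wcoef_commX P i j : wcoef (P * wX - wX * P) i j = wcoef P i j.+1 *+ j.+1.
Proof.
apply: (@bipoly_ind _ _ (fun P : W => wcoef (P * wX - wX * P) i j)
  (fun P : W => wcoef P i j.+1 *+ j.+1)) => [A C|A C|c k l] /=.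
- by rewrite -wcoefB mulrBl mulrBr !opprD addrACA.
- by rewrite wcoefB mulrnBl.
rewrite -/(wmon c k l) wmon_split.
rewrite -!mulrA (commX_normalr wLX) !mulrDr [wX * _]mulrA -wmonC -!mulrA.
have -> : wX ^+ k * (wX * wL ^+ l) = wX * (wX ^+ k * wL ^+ l).
  by rewrite !mulrA -exprSr -exprS.
rewrite addrAC subrr add0r !mulrnAr -!wmon_split.
rewrite wcoefMn !wcoef_mon; case: l => [|l] /=.
  by rewrite !mulr0n mul0rn.
by rewrite eqSS; case: (j =P l) => [->|_]; rewrite ?mulr0n ?mul0rn.
Qed.


Lemma coef_inner_op (Q : M) i : (inner_op Q)`_i = Q`_i.+1 *+ i.+1 + 'X * Q`_i.
Proof. by rewrite coefD coef_deriv coefCM. Qed.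

Lemma size_iter_inner_op (Q : M) j : (size (iter j (@inner_op R) Q) <= size Q)%N.
Proof.
elim: j => //= j; apply: leq_trans; apply/leq_sizeP => i lei.
by rewrite coef_inner_op !nth_default ?mulr0 ?mul0rn ?addr0 // (leqW lei).
Qed.

Lemma coef_iter_inner_op (Q : M) j b : (size Q <= b.+1)%N ->
  (iter j (@inner_op R) Q)`_b = 'X^j * Q`_b.
Proof.
move=> leQ; elim: j => [|j IH]; first by rewrite mul1r.
rewrite iterS coef_inner_op IH exprS -mulrA nth_default ?mul0rn ?add0r //.
by rewrite (leq_trans (size_iter_inner_op _ _)).
Qed.

Lemma size_wmon_mul c i j Q :
  (size ((wmon c i j * Q)%R : M) <= i + size (Q : M))%N.
Proof.
rewrite wmonE mul_polyC (leq_trans (size_scale_leq _ _)) //.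
rewrite (leq_trans (size_polyMleq _ _)) // size_polyXn /= leq_add2l.
exact: size_iter_inner_op.
Qed.

Lemma wsize_sum (I : Type) (r : seq I) (F : I -> W) n :
  (forall i, (size (F i : M) <= n)%N) -> (size ((\sum_(i <- r) F i)%R : M) <= n)%N.
Proof.
move=> leF; apply: (leq_trans (size_sum _ _ _)).
by elim: r => [|k r IH]; rewrite ?big_nil // big_cons geq_max leF.
Qed.

Lemma size_wmul P Q a b : (size (P : M) <= a.+1)%N -> (size (Q : M) <= b.+1)%N ->
  (size ((P * Q)%R : M) <= (a + b).+1)%N.
Proof.
move=> leP leQ; rewrite {1}[P](bimon_sum P) mulr_suml.
apply: wsize_sum => i; rewrite mulr_suml; apply: wsize_sum => j.
apply: (leq_trans (size_wmon_mul _ _ _ _)); rewrite -addnS leq_add //.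
by rewrite -ltnS (leq_trans (ltn_ord i)).
Qed.

(** Moving v past u only creates lower powers of u, so the top coefficients in u multiply as in a
    commutative polynomial ring. *)
Lemma coef_wmul P Q a b : (size (P : M) <= a.+1)%N -> (size (Q : M) <= b.+1)%N ->
  ((P * Q)%R : M)`_(a + b) = (P : M)`_a * (Q : M)`_b.
Proof.
move=> leP leQ; rewrite {1}[P](bimon_sum P) mulr_suml coef_sum.
under eq_bigr do rewrite mulr_suml coef_sum.
have coef0 (i : nat) c j : (i < a)%N -> ((wmon c i j * Q)%R : M)`_(a + b) = 0.
  move=> lti; rewrite nth_default // (leq_trans (size_wmon_mul _ _ _ _)) //.
  by rewrite (leq_trans (leq_add (leqnn i) leQ)) // addnS -addSn leq_add2r.
case: (ltnP a (size (P : M))) => [lta|lea]; last first.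
  rewrite [(P : M)`_a]nth_default // mul0r big1 // => i _; rewrite big1 // => j _.
  by rewrite coef0 // (leq_trans (ltn_ord i)).
rewrite (bigD1 (Ordinal lta)) //= [X in _ + X]big1 ?addr0; last first.
  move=> i; rewrite -val_eqE /= => nia; rewrite big1 // => j _.
  by rewrite coef0 // ltn_neqAle nia -ltnS (leq_trans (ltn_ord i)).
rewrite -[(P : M)`_a in RHS]coefK poly_def mulr_suml; apply: eq_bigr => j _.
rewrite wmonE coefCM coefXnM ltnNge leq_addr /= addKn coef_iter_inner_op //.
by rewrite mulrA mul_polyC.
Qed.

Lemma wexp_lead P a n : (size (P : M) <= a.+1)%N ->
  (size ((P ^+ n)%R : M) <= (n * a).+1)%N /\
  ((P ^+ n)%R : M)`_(n * a) = (P : M)`_a ^+ n.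
Proof.
move=> leP; elim: n => [|n [IHs IHc]].
  by rewrite !expr0 wone_poly size_poly1 coef1.
by rewrite !exprS mulSn size_wmul // coef_wmul // IHc.
Qed.

Definition inner_le b (P : M) := forall i, (size (P`_i)%R <= b.+1)%N.

Lemma inner_le_op b Q : inner_le b Q -> inner_le b.+1 (inner_op Q).
Proof.
move=> leQ i; rewrite coef_inner_op (leq_trans (size_polyD _ _)) // geq_max.
rewrite -scaler_nat (leq_trans (size_scale_leq _ _)) ?(leq_trans (leQ _)) //=.
by rewrite (leq_trans (size_polyMleq _ _)) // size_polyX /= ltnS.
Qed.

Lemma inner_le_mul b b' P Q : inner_le b P -> inner_le b' Q ->
  inner_le (b + b') (P * Q : W).
Proof.
move=> leP leQ k; rewrite [P in (P * Q)](bimon_sum P) mulr_suml coef_sum.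
rewrite (leq_trans (size_sum _ _ _)) //; apply/bigmax_leqP => i _.
rewrite mulr_suml coef_sum.
rewrite (leq_trans (size_sum _ _ _)) //; apply/bigmax_leqP => j _.
rewrite wmonE coefCM mul_polyC (leq_trans (size_scale_leq _ _)) // coefXnM.
case: ifP => _; first by rewrite size_poly0.
have leit : inner_le (j + b') (iter j (@inner_op R) Q).
  by elim: {+}(nat_of_ord j) => //= l; rewrite addSn; apply: inner_le_op.
rewrite (leq_trans (leit _)) // ltnS leq_add2r.
by rewrite -ltnS (leq_trans (ltn_ord j)).
Qed.

Lemma inner_le_exp b P n : inner_le b P -> inner_le (n * b) (P ^+ n : W).
Proof.
move=> leP; elim: n => [|n IH]; last by rewrite exprS mulSn; apply: inner_le_mul.
move=> i; rewrite expr0 wone_poly coef1.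
by case: (_ == _); rewrite ?size_poly1 ?size_poly0.
Qed.

End WpolyTheory.

Lemma mulrn_coprime (V : zmodType) (x : V) m n :
  coprime m n -> x *+ m = 0 -> x *+ n = 0 -> x = 0.
Proof.
case: m => [|m]; first by rewrite /coprime gcd0n => /eqP -> _; rewrite mulr1n.
case/coprimeP => // -[a b] /= ab xm xn.
have lt : (b * n <= a * m.+1)%N by rewrite ltnW // -subn_gt0 ab.
rewrite -[x]mulr1n -ab mulrnBr // (mulnC a) (mulnC b) 2!mulrnA xm xn.
by rewrite !mul0rn subrr.
Qed.

Lemma dvdn_ffact_mul p k r : (0 < r)%N -> (p %| (k * p) ^_ r)%N.
Proof. by case: r => // r _; rewrite ffactnS dvdn_mulr ?dvdn_mull. Qed.

Lemma coprime_fact p n : prime p -> (n < p)%N -> coprime n`! p.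
Proof.
move=> p_pr; elim: n => [|n IH] ltn; first exact: coprime1n.
rewrite factS coprimeMl IH ?(ltnW ltn) // andbT coprime_sym prime_coprime //.
by apply/negP => /(dvdn_leq (ltn0Sn n)); rewrite leqNgt ltn.
Qed.

(** * Centrality of p-th powers *)

Section CharPolyWeyl.
Variables (C : comNzRingType) (n : nat).
Hypotheses (p_pr : prime n.+1) (charC : n.+1%:R = 0 :> C).
Variables A B : 'M[C]_n.+1.
Hypothesis BA : B * A - A * B = 1.

Lemma comm_horner_mx q :
  B * horner_mx A q - horner_mx A q * B = horner_mx A q^`().
Proof.
elim/poly_ind: q => [|q c IH]; first by rewrite deriv0 rmorph0 mulr0 mul0r subrr.
rewrite derivD derivC addr0 derivM derivX mulr1 !rmorphD !rmorphM /= horner_mx_X.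
rewrite horner_mx_C -IH mulrDr mulrDl opprD addrACA.
have -> : B * c%:M - c%:M * B = 0 :> 'M_n.+1 by rewrite [_ * _]scalar_mxC subrr.
rewrite addr0 -[X in _ = _ + X]mulr1 -BA mulrBr mulrBl !mulrA.
by rewrite addrA subrK.
Qed.

(* Bracketing with B differentiates polynomials in A, so all derivatives of the
   characteristic polynomial kill A; going down from degree p, the j-th one
   reduces to the constant j! a_j. *)
Lemma char_poly_weyl j : (0 < j < n.+1)%N -> (char_poly A)`_j = 0.
Proof.
set chi := char_poly A => /andP[j_gt0 ltj].
have chi_top : chi`_n.+1 = 1.
  by have /monicP := char_poly_monic A; rewrite lead_coefE size_char_poly.
have chi_der k : horner_mx A chi^`(k) = 0.
  elim: k => [|k IH]; first exact: Cayley_Hamilton.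
  by rewrite derivnS -comm_horner_mx IH mulr0 mul0r subrr.
have [k lek] := ubnP (n.+1 - j); elim: k j j_gt0 ltj lek => // k IH j j_gt0 ltj ltk.
have chi_j : chi^`(j) = (chi`_j *+ j`!)%:P.
  apply/polyP => i; rewrite coef_derivn coefC; case: i => [|i].
    by rewrite addn0 ffactnn.
  rewrite addnS; have [lti|gti|ei] := ltngtP (j + i).+1 n.+1.
  - by rewrite IH ?mul0rn //; lia.
  - by rewrite nth_default ?mul0rn // size_char_poly.
  - rewrite ei chi_top; have /dvdnP[m] := dvdn_ffact_mul n.+1 1 j_gt0; rewrite mul1n => ->.
    by rewrite mulnC mulrnA charC mul0rn.
have := chi_der j; rewrite chi_j horner_mx_C => /matrixP/(_ 0 0).
rewrite !mxE eqxx mulr1n => jf0; apply: mulrn_coprime (coprime_fact p_pr ltj) jf0 _.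
by rewrite -mulr_natr charC mulr0.
Qed.

(** With its middle coefficients gone, the characteristic polynomial is X^p + a_0, and
    Cayley-Hamilton reads A^p = -a_0. *)
Lemma scalar_expr : exists m, A ^+ n.+1 = m%:M.
Proof.
exists (- (char_poly A)`_0); apply/eqP.
rewrite -subr_eq0 rmorphN opprK -(Cayley_Hamilton A); apply/eqP.
have chiE : char_poly A = 'X^(n.+1) + ((char_poly A)`_0)%:P.
  apply/polyP => i; rewrite coefD coefXn coefC.
  case: i => [|i]; first by rewrite add0r.
  rewrite addr0; have [lti|gti|[->]] := ltngtP i.+1 n.+1.
  - exact: char_poly_weyl.
  - by rewrite nth_default // size_char_poly.
  - by have /monicP := char_poly_monic A; rewrite lead_coefE size_char_poly.
by rewrite [in RHS]chiE rmorphD /= horner_mx_C rmorphXn /= horner_mx_X.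
Qed.

End CharPolyWeyl.

Section MatrixModel.
Variables (S : comNzRingType) (n : nat).
Hypotheses (p_pr : prime n.+1) (charS : n.+1%:R = 0 :> S).
Local Notation C := {poly {poly S}}.

(* u and v acting on S[u, v] seen as a free module over S[u^p, v], with basis
   1, u, .., u^(p-1): v acts as d/du + v. In C the outer variable is u^p. *)
Definition mx_u : 'M[C]_n.+1 := \matrix_(a, b)
  (if (b < n)%N then (a == b.+1 :> nat)%:R else 'X *+ (a == 0 :> nat)).

Definition mx_v : 'M[C]_n.+1 := \matrix_(a, b)
  ('X%:P *+ (a == b :> nat) + b%:R *+ (a.+1 == b :> nat)).

Lemma mx_u_mull (A : 'M[C]_n.+1) a b :
  (A * mx_u) a b = if (b < n)%N then A a (inord b.+1) else 'X * A a ord0.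
Proof.
rewrite mxE; case: ltnP => [ltb|leb].
  rewrite (bigD1 (inord b.+1)) //= mxE ltb inordK // eqxx mulr1 big1 ?addr0 // => c nc.
  rewrite mxE ltb; case: eqP => [cb|_]; last by rewrite mulr0.
  by case/eqP: nc; apply: val_inj; rewrite /= inordK // -cb.
rewrite (bigD1 ord0) //= mxE ltnNge leb /= mulrC big1 ?addr0 ?mulr1n // => c nc.
rewrite mxE ltnNge leb /=; case: eqP => [c0|_]; last by rewrite mulr0n mulr0.
by case/eqP: nc; apply: val_inj.
Qed.

Lemma mx_u_mulr (A : 'M[C]_n.+1) a b :
  (mx_u * A) a b = if (0 < a)%N then A (inord a.-1) b else 'X * A ord_max b.
Proof.
rewrite mxE; case: ltnP => [lta|lea].
  have a1 : (a.-1 < n)%N by have := ltn_ord a; lia.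
  rewrite (bigD1 (inord a.-1)) //= mxE inordK ?(leqW a1) // a1 prednK // eqxx mul1r.
  rewrite big1 ?addr0 // => c nc; rewrite mxE.
  case: ltnP => [ltc|_]; last by rewrite (gtn_eqF lta) mulr0n mul0r.
  case: eqP => [ac|_]; last by rewrite mul0r.
  by case/eqP: nc; apply: val_inj; rewrite /= inordK ?(leqW a1) // ac.
have a0 : a = 0 :> nat by apply/eqP; rewrite -leqn0.
rewrite (bigD1 ord_max) //= mxE ltnn a0 big1 ?addr0 ?mulr1n // => c nc.
rewrite mxE a0 /=; case: ltnP => [_|lec]; first by rewrite mul0r.
by case/eqP: nc; apply: val_inj => /=; apply/eqP; rewrite eqn_leq lec -ltnS ltn_ord.
Qed.

Lemma pchar_bipoly0 : n.+1%:R = 0 :> C.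
Proof. by rewrite -!polyC_natr charS. Qed.

Lemma mx_vu : mx_v * mx_u - mx_u * mx_v = 1.
Proof.
have n_gt0 : (0 < n)%N by have := prime_gt1 p_pr.
apply/matrixP => a b; rewrite !mxE -[LHS]/(_ - _).
have := mx_u_mull mx_v a b; rewrite mxE => ->.
have := mx_u_mulr mx_v a b; rewrite mxE => ->.
rewrite !mxE /= -val_eqE /=; case: ltnP => [ltb|leb]; case: ltnP => [lta|lea].
- have a1 : (a.-1 < n.+1)%N by have := ltn_ord a; lia.
  have ba : (a.-1 == b :> nat) = (a == b.+1 :> nat) by lia.
  rewrite (inordK (ltb : (b.+1 < n.+1)%N)) (inordK a1) (prednK lta) eqSS ba.
  by rewrite opprD addrACA subrr add0r -mulrnBl mulrSr addrAC subrr add0r.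
- have a0 : a = 0 :> nat by lia.
  have [nb nb1] : (n == b :> nat) = false /\ (n.+1 == b :> nat) = false by lia.
  rewrite (inordK (ltb : (b.+1 < n.+1)%N)) a0 nb nb1 eqSS !mulr0n addr0 mulr0 subr0.
  by rewrite add0r; case: (0%N =P b) => [<-|_]; rewrite ?mulr0n ?mulr1n.
- have eb : b = n :> nat by have := ltn_ord b; lia.
  have a1 : (a.-1 < n.+1)%N by have := ltn_ord a; lia.
  have an : (a.-1 == n :> nat) = false by have := ltn_ord a; lia.
  rewrite (inordK a1) (prednK lta) eb an (gtn_eqF lta) !mulr0n addr0 mulr0 !add0r.
  rewrite -mulNrn.
  (* u sends the last basis vector u^(p-1) to the scalar u^p, whose derivative must vanish; the
     entry -(p-1) is 1 because p = 0. *)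
  suff -> : - n%:R = 1 :> C by [].
  by apply/eqP; rewrite -subr_eq0 -opprD oppr_eq0 -mulrSr pchar_bipoly0.
- have a0 : a = 0 :> nat by lia.
  have eb : b = n :> nat by have := ltn_ord b; lia.
  have n1 : (n.+1 == n :> nat) = false by lia.
  have n0 : (0%N == n :> nat) = false by lia.
  by rewrite a0 eb eqxx n1 n0 !mulr0n !mulr1n !addr0 subrr.
Qed.

Lemma mx_uX i a : (mx_u ^+ i) a ord0 = 'X^(i %/ n.+1)%N *+ (a == i %% n.+1 :> nat)%N.
Proof.
elim: i a => [|i IH] a; first by rewrite div0n mod0n mxE -val_eqE.
rewrite exprS mx_u_mulr !IH divnS // modnS.
have ri : (i %% n.+1 < n.+1)%N by rewrite ltn_mod.
have -> : (n.+1 %| i.+1)%N = (i %% n.+1 == n)%N.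
  rewrite {1}(divn_eq i n.+1) -addnS dvdn_addr ?dvdn_mull //.
  apply/idP/eqP => [/dvdn_leq|->] //; lia.
case: ltnP => [lta|lea].
  rewrite inordK; last by have := ltn_ord a; lia.
  case: ((i %% n.+1)%N =P n) => [->|_]; last by rewrite -eqSS (prednK lta).
  have -> : (a.-1 == n :> nat) = false by have := ltn_ord a; lia.
  by rewrite (gtn_eqF lta) !mulr0n.
have a0 : a = 0 :> nat by lia.
rewrite a0 eq_sym; case: ((i %% n.+1)%N =P n) => [_|_] /=; last first.
  by rewrite !mulr0n mulr0.
by rewrite !mulr1n add1n exprS.
Qed.

Lemma mx_vX j a : (mx_v ^+ j) a ord0 = 'X%:P ^+ j *+ (a == ord0).
Proof.
elim: j a => [|j IH] a; first by rewrite mxE.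
rewrite exprS mxE (bigD1 ord0) //= IH eqxx mulr1n big1 ?addr0; last first.
  by move=> c /negPf nc; rewrite IH nc mulr0n mulr0.
by rewrite mxE /= mulr0n addr0 exprS mulrnAl.
Qed.

Section Model.
Variables (R : comNzRingType) (f : {rmorphism R -> S}).
Implicit Types P Q : wpoly R.

Definition mx_scal : R -> 'M[C]_n.+1 := fun c => (f c)%:P%:P%:M.

Lemma mx_scal_is_zmod : zmod_morphism mx_scal.
Proof. by move=> c d; rewrite /mx_scal !rmorphB. Qed.

Lemma mx_scal_is_monoid : monoid_morphism mx_scal.
Proof.
by split=> [|c d]; rewrite /mx_scal ?rmorph1 // !rmorphM.
Qed.

HB.instance Definition _ :=
  GRing.isZmodMorphism.Build R 'M[C]_n.+1 mx_scal mx_scal_is_zmod.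
HB.instance Definition _ :=
  GRing.isMonoidMorphism.Build R 'M[C]_n.+1 mx_scal mx_scal_is_monoid.

Definition mx_model : wpoly R -> 'M[C]_n.+1 := weval mx_scal mx_u mx_v.

Lemma mx_scal_comm c (A : 'M[C]_n.+1) : GRing.comm (mx_scal c) A.
Proof. exact/esym/scalar_mxC. Qed.

Lemma mx_modelM : {morph mx_model : P Q / P * Q}.
Proof.
by apply: wevalM => [c|c|]; [exact: mx_scal_comm | exact: mx_scal_comm | exact: mx_vu].
Qed.

Lemma mx_modelB : {morph mx_model : P Q / P - Q}.
Proof. exact: wevalB. Qed.

Lemma mx_model1 : mx_model 1 = 1.
Proof. exact: weval1. Qed.

Lemma mx_modelX k : {morph mx_model : P / P ^+ k}.
Proof.
by apply: wevalX => [c|c|]; [exact: mx_scal_comm | exact: mx_scal_comm | exact: mx_vu].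
Qed.

(** Column 0 is the image of the basis vector 1, which is the symbol of P itself, with each exponent
    of u divided by p with remainder. Hence the model loses nothing beyond the kernel of [f]. *)
Lemma coef_mx_model P (b : 'I_n.+1) a j :
  (mx_model P b ord0)`_a`_j = f (wcoef P (a * n.+1 + b) j).
Proof.
apply: (@bipoly_ind _ _ (fun P : wpoly R => (mx_model P b ord0)`_a`_j)
  (fun P : wpoly R => f (wcoef P (a * n.+1 + b) j))) => [A D|A D|c k l] /=.
- by rewrite mx_modelB !mxE !coefB.
- by rewrite wcoefB rmorphB.
rewrite -/(wmon c k l) wcoef_mon /mx_model weval_bimon.
have -> : (mx_scal c * (mx_u ^+ k * mx_v ^+ l)) b ord0
    = bimon (f c) (k %/ n.+1) l *+ (b == k %% n.+1 :> nat)%N.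
  rewrite -[_ * (_ * _)]/(_ *m _) mul_scalar_mx mxE mxE (bigD1 ord0) //= mx_vX mx_uX.
  rewrite eqxx mulr1n big1 ?addr0; last first.
    by move=> i /negPf ni; rewrite mx_vX ni mulr0n mulr0.
  rewrite mulrnAl mulrnAr; congr (_ *+ _).
  by rewrite [X in _ * X = _]mulrC mulrA -rmorphXn -polyCM [_%:P * 'X^l]mul_polyC.
rewrite !coefMn coef_bimon !rmorphMn /= -!mulrnA; congr (_ *+ _).
have -> : (a * n.+1 + b == k)%N = (b == k %% n.+1 :> nat)%N && (a == k %/ n.+1)%N.
  apply/eqP/andP => [<-|[/eqP -> /eqP ->]]; last by rewrite -divn_eq.
  by rewrite divnMDl // modnMDl divn_small ?addn0 ?modn_small ?eqxx.
by rewrite -mulnb [((j == l) * _)%N]mulnC mulnA [((a == _) * _)%N]mulnC.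
Qed.

Lemma mx_model_eq0 P : mx_model P = 0 -> forall i j, f (wcoef P i j) = 0.
Proof.
move=> P0 i j; have lti : (i %% n.+1 < n.+1)%N by rewrite ltn_mod.
have := coef_mx_model P (Ordinal lti) (i %/ n.+1) j.
by rewrite P0 mxE !coef0 /= -divn_eq.
Qed.

(** In column 0 a scalar matrix has only its entry in row 0, so only exponents of u divisible by p
    survive. A scalar also commutes with u, so the derivative in v vanishes, which leaves only
    exponents of v divisible by p. *)
Lemma mx_model_scalar P m : mx_model P = m%:M ->
  forall i j, ~~ ((n.+1 %| i) && (n.+1 %| j))%N -> f (wcoef P i j) = 0.
Proof.
move=> Pm i j; rewrite negb_and => /orP[ndi|ndj].
  have lti : (i %% n.+1 < n.+1)%N by rewrite ltn_mod.
  have := coef_mx_model P (Ordinal lti) (i %/ n.+1) j.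
  rewrite /= -divn_eq => <-; rewrite Pm mxE -val_eqE /=.
  by move: ndi; rewrite /dvdn => /negPf ->; rewrite mulr0n !coef0.
case: j ndj => [|j ndj]; first by rewrite dvdn0.
have : mx_model (P * wX R - wX R * P) = 0.
  by rewrite mx_modelB !mx_modelM Pm [X in _ - X]scalar_mxC subrr.
move/mx_model_eq0/(_ i j); rewrite wcoef_commX rmorphMn => h.
apply: (@mulrn_coprime _ _ _ n.+1 _ h); last by rewrite -mulr_natr charS mulr0.
by rewrite coprime_sym prime_coprime.
Qed.

Lemma mx_model_expr U V : V * U - U * V = 1 ->
  exists m, mx_model (U ^+ n.+1) = m%:M.
Proof.
move=> VU; have [|m Um] := @scalar_expr C n p_pr pchar_bipoly0 (mx_model U) (mx_model V).
  by rewrite -!mx_modelM -mx_modelB VU mx_model1.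
by exists m; rewrite mx_modelX.
Qed.

End Model.
End MatrixModel.

(** * The Newton polygon argument *)

Section Polygon.
Import Order.TTheory Num.Theory.

Variables (R : comNzRingType) (Q : {pred R}) (D : nat).
Hypotheses (Q0 : 0 \in Q) (QB : {in Q &, forall x y, x - y \in Q})
  (QM : forall r x, x \in Q -> r * x \in Q)
  (Qprime : forall x y, x * y \in Q -> (x \in Q) || (y \in Q))
  (Qnat : forall m, (0 < m <= D * D)%N -> m%:R \notin Q).
Variables v w : nat -> nat -> R.
Hypotheses (vD : forall k l, v k l \notin Q -> (k < D)%N && (l < D)%N)
  (wD : forall i j, w i j \notin Q -> (i < D)%N && (j < D)%N)
  (v_odd : forall k l, ~~ odd l -> v k l \in Q)
  (w_even : forall i j, odd j -> w i j \in Q).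

(** For G with coefficients [v] and H with coefficients [w] in commuting variables s, t, this is the
    contribution of the monomials s^k t^l and s^i t^j to G_t H_s - G_s H_t; differentiation lowers
    both total exponents by one, hence the shift in [jac_index]. *)
Definition jac_term (q : 'I_D * 'I_D * ('I_D * 'I_D)) : R :=
  v q.1.1 q.1.2 * w q.2.1 q.2.2 * ((q.1.2 * q.2.1)%:R - (q.1.1 * q.2.2)%:R).

Definition jac_index a b (q : 'I_D * 'I_D * ('I_D * 'I_D)) : bool :=
  (q.1.1 + q.2.1 == a.+1)%N && (q.1.2 + q.2.2 == b.+1)%N.

Hypothesis jacobian1 : forall a b,
  \sum_(q | jac_index a b q) jac_term q - ((a == 0) && (b == 0))%N%:R \in Q.

Lemma idealN x : x \in Q -> - x \in Q.
Proof. by move=> Qx; rewrite -sub0r QB. Qed.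

Lemma idealD : {in Q &, forall x y, x + y \in Q}.
Proof. by move=> x y Qx Qy; rewrite -[y]opprK QB // idealN. Qed.

(** Serves at corners of the Newton polygons: every other pair with the same exponent sum has a
    coefficient in Q or determinant 0, so a single product remains of that coefficient of the
    Jacobian. *)
Lemma jac_extract k l i j : (k < D)%N -> (l < D)%N -> (i < D)%N -> (j < D)%N ->
    (0 < k + i)%N -> (0 < l + j)%N ->
    (forall k' l' i' j', v k' l' \notin Q -> w i' j' \notin Q ->
       (k' + i' = k + i)%N -> (l' + j' = l + j)%N ->
       [/\ k' = k, l' = l, i' = i & j' = j] \/ (l' * i' = k' * j')%N) ->
  v k l * w i j * ((l * i)%:R - (k * j)%:R)
    - ((k + i == 1) && (l + j == 1))%N%:R \in Q.
Proof.
move=> ltk ltl lti ltj ki lj other.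
pose q0 := ((Ordinal ltk, Ordinal ltl), (Ordinal lti, Ordinal ltj)).
have := jacobian1 (k + i).-1 (l + j).-1.
rewrite (bigD1 q0) /=; last by rewrite /jac_index /= !prednK ?eqxx.
have -> : ((k + i).-1 == 0)%N = (k + i == 1)%N by lia.
have -> : ((l + j).-1 == 0)%N = (l + j == 1)%N by lia.
set s := \sum_(q | _) _ => Qs.
suff Qsum : s \in Q by have := QB Qs Qsum; rewrite /jac_term /= addrAC addrK.
apply: (big_ind (fun x => x \in Q)) => // [x y|[[k' l'] [i' j']]]; first exact: idealD.
rewrite /jac_index /jac_term /= !prednK // => /andP[/andP[/eqP eki /eqP elj] nq].
case: (boolP (v k' l' \in Q)) => [Qv|nv].
  by rewrite -mulrA mulrC QM.
case: (boolP (w i' j' \in Q)) => [Qw|nw].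
  by rewrite mulrC mulrA QM.
have [[ek el ei ej]|->] := other _ _ _ _ nv nw eki elj.
  case/eqP: nq; congr (_, _, (_, _)); exact: val_inj.
by rewrite subrr mulr0.
Qed.

Lemma Q_not1 : (0 < D)%N -> 1 \notin Q.
Proof. by move=> D_gt0; rewrite -[1]/(1%:R) Qnat //= muln_gt0 D_gt0. Qed.

Lemma jac_contra k l i j : v k l \notin Q -> w i j \notin Q ->
    (k * j < l * i)%N -> ((k + i != 1) || (l + j != 1))%N ->
    (forall k' l' i' j', v k' l' \notin Q -> w i' j' \notin Q ->
       (k' + i' = k + i)%N -> (l' + j' = l + j)%N ->
       [/\ k' = k, l' = l, i' = i & j' = j] \/ (l' * i' = k' * j')%N) ->
  False.
Proof.
move=> nv nw lt_kj n1 other.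
have /andP[ltk ltl] := vD nv; have /andP[lti ltj] := wD nw.
have [ki lj] : (0 < k + i)%N /\ (0 < l + j)%N by nia.
have := jac_extract ltk ltl lti ltj ki lj other.
rewrite -negb_and in n1; rewrite (negPf n1) subr0 -natrB ?(ltnW lt_kj) //.
move=> /Qprime/orP[/Qprime/orP[]|]; rewrite ?(negPf nv) ?(negPf nw) //.
have : (0 < l * i - k * j <= D * D)%N by rewrite subn_gt0 lt_kj /=; nia.
by move/Qnat/negPf ->.
Qed.

Hypothesis D2 : (1 < D)%N.

(** In the constant term of the Jacobian, parity forces l = 1 and j = 0, and the pair with k = 1, i
    = 0 has determinant 0. What remains is [v 0 1 * w 1 0] = 1 modulo Q. *)
Lemma low_corners : v 0 1 \notin Q /\ w 1 0 \notin Q.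
Proof.
have D1 : (0 < D)%N by exact: ltnW.
have := @jac_extract 0 1 1 0 D1 D2 D2 D1 isT isT.
rewrite !addn0 !add0n mul1n mul0n /= subr0 mulr1 => h.
have {h} : v 0 1 * w 1 0 - 1 \in Q.
  apply: h => k l i j nv nw ki lj.
  have ol : odd l by apply: contraR nv => /v_odd.
  have ej : ~~ odd j by apply: contra nw => /w_even.
  have [el ej0] : l = 1%N /\ j = 0%N by case: l j ol ej lj {nv nw} => [|[|l]] [|[|j]] //; lia.
  subst; case: k ki {nv} => [|k] ki; first by left; split; lia.
  by right; lia.
move=> Qvw; have n1 := Q_not1 D1; split; apply: contra n1 => Qx.
  by rewrite -[1](subKr (v 0 1 * w 1 0)) QB // mulrC QM.
by rewrite -[1](subKr (v 0 1 * w 1 0)) QB // QM.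
Qed.

(** Write A(s) for the part of [v] linear in t and B(s) for the part of [w] free of t. On t = 0 the
    Jacobian is A B' = 1, so the top exponents of A and B add up to 1, while B has exponent at least
    1. *)
Lemma low_edge : (forall k, v k 1 \notin Q -> k = 0%N)
  /\ (forall i, w i 0 \notin Q -> (i <= 1)%N).
Proof.
have [v01 w10] := low_corners.
have exv : exists k, v k 1 \notin Q by exists 0%N.
have exw : exists i, w i 0 \notin Q by exists 1%N.
have vb k : v k 1 \notin Q -> (k <= D)%N by move/vD/andP => [/ltnW].
have wb i : w i 0 \notin Q -> (i <= D)%N by move/wD/andP => [/ltnW].
case: (ex_maxnP exv vb) => K vK maxK; case: (ex_maxnP exw wb) => I wI maxI.
have I1 := maxI _ w10.
have KI : (K + I == 1)%N.
  apply/negPn/negP => n1; apply: (jac_contra vK wI); rewrite ?n1 //; first by lia.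
  move=> k l i j nv nw ki lj.
  have ol : odd l by apply: contraR nv => /v_odd.
  have [el ej0] : l = 1%N /\ j = 0%N by case: l ol lj {nv nw} => [|l] //; lia.
  subst; left; have := maxK _ nv; have := maxI _ nw; split; lia.
split=> [k /maxK|i /maxI]; lia.
Qed.

(* Otherwise let d > 0 be the steepest slope of the lines through (0, 1), bounding
   the support of v, and through (1, 0), bounding that of w. The products of the
   two top corners on these lines cannot cancel in the Jacobian. *)
Lemma polygon k l : (0 < k)%N -> v k l \in Q.
Proof.
move=> k_gt0; apply/negPn/negP => nv0.
have [v1 w0] := low_edge; have [v01 w10] := low_corners.
have v_ge k' l' : v k' l' \notin Q -> (0 < l')%N.
  by case: l' => // /negPf; rewrite v_odd.
have l_gt1 : (1 < l)%N.
  by have := v_ge _ _ nv0; case: l nv0 => [|[|l]] // /v1; lia.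
have /andP[ltk ltl] := vD nv0.
(* The tag separates points of [v] (true) from points of [w] (false), so that one maximum covers
   both supports. *)
pose slope (t : bool * ('I_D * 'I_D)) : rat :=
  if t.1 then t.2.1%:R / (t.2.2%:R - 1) else (t.2.1%:R - 1) / t.2.2%:R.
pose P (t : bool * ('I_D * 'I_D)) :=
  if t.1 then (v t.2.1 t.2.2 \notin Q) && (1 < t.2.2)%N
  else (w t.2.1 t.2.2 \notin Q) && (0 < t.2.2)%N.
have Pt0 : P (true, (Ordinal ltk, Ordinal ltl)) by rewrite /P /= nv0.
case: (arg_maxP slope Pt0) => tm Ptm max_tm.
set d := slope tm in max_tm.
have d_gt0 : 0 < d.
  apply: lt_le_trans (max_tm _ Pt0); rewrite /slope /=.
  by rewrite divr_gt0 ?ltr0n // subr_gt0 ltr1n.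
have v_le k' l' : v k' l' \notin Q -> k'%:R <= d * (l'%:R - 1).
  move=> nv; have := v_ge _ _ nv; rewrite leq_eqVlt => /orP[/eqP el|gtl].
    by move: nv; rewrite -el => /v1 ->; rewrite subrr mulr0.
  have /andP[ltk' ltl'] := vD nv.
  have Pt : P (true, (Ordinal ltk', Ordinal ltl')) by rewrite /P /= nv.
  have := max_tm _ Pt; rewrite /slope /= -/d ler_pdivrMr //.
  by rewrite subr_gt0 ltr1n.
have w_le i j : w i j \notin Q -> i%:R - 1 <= d * j%:R.
  move=> nw; case: (posnP j) => [j0|j_gt0].
    by move: nw; rewrite j0 => /w0 i1; rewrite mulr0 subr_le0 lern1.
  have /andP[lti ltj] := wD nw.
  have Pt : P (false, (Ordinal lti, Ordinal ltj)) by rewrite /P /= nw.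
  by have := max_tm _ Pt; rewrite /slope /= -/d ler_pdivrMr // ltr0n.
pose vedge l := [exists k : 'I_D, (v k l \notin Q) && (k%:R == d * (l%:R - 1))].
pose wedge j := [exists i : 'I_D, (w i j \notin Q) && (i%:R - 1 == d * j%:R)].
have D1 : (0 < D)%N by exact: ltnW.
have exv : exists l, vedge l.
  by exists 1%N; apply/existsP; exists (Ordinal D1); rewrite v01 /= subrr mulr0.
have exw : exists j, wedge j.
  by exists 0%N; apply/existsP; exists (Ordinal D2); rewrite w10 /= subrr mulr0.
have vb l' : vedge l' -> (l' <= D)%N.
  by case/existsP => k' /andP[/vD/andP[_ /ltnW]].
have wb j' : wedge j' -> (j' <= D)%N.
  by case/existsP => i' /andP[/wD/andP[_ /ltnW]].
case: (ex_maxnP exv vb) => L /existsP[K /andP[vKL /eqP eKL]] maxL.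
case: (ex_maxnP exw wb) => J /existsP[I /andP[wIJ /eqP eIJ]] maxJ.
have L_gt0 := v_ge _ _ vKL.
(* The point of maximal slope lies on its own line, above the base point, so the two corners are not
   both base points. *)
have LJ : (1 < L + J)%N.
  move: Ptm; rewrite /P; case et : tm => [[] [k' l']] /= /andP[n1 gt1].
    have : vedge l'.
      apply/existsP; exists k'; rewrite n1 /d et /slope /= divfK //.
      by rewrite subr_eq0 pnatr_eq1 gtn_eqF.
    by move/maxL; lia.
  have : wedge l'.
    apply/existsP; exists k'; rewrite n1 /d et /slope /= divfK //.
    by rewrite pnatr_eq0 -lt0n.
  by move/maxJ; lia.
apply: (jac_contra vKL wIJ).
(* The determinant is L I - K J = L (1 + d J) - d (L - 1) J = L + d J, which is positive. *)
- rewrite -(ltr_nat rat) !natrM eKL -[(I : nat)%:R](subrK 1) eIJ.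
  have L0 : 0 < L%:R :> rat by rewrite ltr0n.
  have dJ0 : 0 <= d * J%:R by rewrite mulr_ge0 ?ler0n // ltW.
  rewrite -subr_gt0 [X in 0 < X](_ : _ = L%:R + d * J%:R) ?ltr_wpDr //; ring.
- by rewrite (gtn_eqF LJ) orbT.
(* The two line inequalities add up to an equality, so both points lie on the lines; maximality of L
   and J then pins them down. *)
move=> k' l' i' j' nv nw eki elj; left.
have := v_le _ _ nv; have := w_le _ _ nw => lew lev.
have eki' : k'%:R + i'%:R = K%:R + I%:R :> rat by rewrite -!natrD eki.
have elj' : l'%:R + j'%:R = L%:R + J%:R :> rat by rewrite -!natrD elj.
have dlj : d * l'%:R + d * j'%:R = d * L%:R + d * J%:R by rewrite -!mulrDr elj'.
have [ek ei] : k'%:R = d * (l'%:R - 1) /\ i'%:R - 1 = d * j'%:R.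
  by move: lev lew eki' dlj eKL eIJ; rewrite !mulrBr !mulr1; clear; split; lra.
have lel : (l' <= L)%N.
  have /andP[ltk' _] := vD nv.
  by apply: maxL; apply/existsP; exists (Ordinal ltk'); rewrite nv /= ek.
have lej : (j' <= J)%N.
  have /andP[lti' _] := wD nw.
  by apply: maxJ; apply/existsP; exists (Ordinal lti'); rewrite nw /= ei.
have el : l' = L by clear -lel lej elj; lia.
have ej : j' = J by clear -lel lej elj; lia.
have ek' : k' = K by apply/eqP; rewrite -(eqr_nat rat) ek eKL el.
split=> //; clear -ek' eki; lia.
Qed.

End Polygon.

Lemma eqmod_cancelr p c a b :
  coprime p c -> (a * c = b * c %[mod p])%N -> (a = b %[mod p])%N.
Proof.
move=> co; wlog leba : a b / (b <= a)%N => [IH|/eqP].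
  by have [/IH|/ltnW/IH h /esym/h/esym] := leqP b a.
rewrite eqn_mod_dvd ?leq_mul2r ?leba ?orbT // -mulnBl Gauss_dvdl //.
by rewrite -eqn_mod_dvd // => /eqP.
Qed.

(** * Commutators modulo p^2 *)

Section FactorialModp.
Variable p : nat.
Hypothesis p_pr : prime p.

Lemma ffact_addp m a b : (b <= a)%N -> ((m * p + a) ^_ b = a ^_ b %[mod p])%N.
Proof.
elim: b => [|b IH] leb; first by rewrite !ffactn0.
by rewrite !ffactnSr -modnMm IH ?(ltnW leb) // -addnBA ?(ltnW leb) // modnMDl modnMm.
Qed.

(** For l > 0, the p consecutive factors consist of lp and one representative of each nonzero class
    modulo p. *)
Lemma ffact_mulp l : exists2 x, ((l * p) ^_ p = p * (l * x))%N & (x = p.-1`! %[mod p])%N.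
Proof.
have p_gt0 := prime_gt0 p_pr; case: l => [|l].
  by exists p.-1`!; rewrite ?mul0n ?muln0 // ffact0n gtn_eqF.
exists ((l * p + p.-1) ^_ p.-1); last by rewrite ffact_addp // ffactnn.
have ffactS m : (m.+1 ^_ p = m.+1 * m ^_ p.-1)%N by case: (p) p_gt0.
have e : (l.+1 * p = (l * p + p.-1).+1)%N by rewrite mulSn; lia.
by rewrite [in LHS]e ffactS -e -mulnA mulnCA.
Qed.

Lemma fact_prime : (p`! = p * p.-1`!)%N.
Proof. by case: (p) (prime_gt0 p_pr). Qed.

Lemma bin_mulp l : ('C(l * p, p) = l %[mod p])%N.
Proof.
have p_gt0 := prime_gt0 p_pr; have [x e xp] := ffact_mulp l.
have e' : ('C(l * p, p) * p.-1`! = l * x)%N.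
  by apply/eqP; rewrite -(eqn_pmul2l p_gt0) -e -bin_ffact mulnCA -fact_prime.
apply: (@eqmod_cancelr _ p.-1`!).
  by rewrite coprime_sym coprime_fact // prednK.
by rewrite e' -modnMmr xp modnMmr.
Qed.

(** The binomial is l modulo p, and the falling factorial supplies the factor p. Keeping p!
    unevaluated makes it cancel against the p! in [V^p, U^p]. *)
Lemma bin_ffact_mulp l i :
  ('C(l * p, p) * (i * p) ^_ p = p`! * (l * i) %[mod p ^ 2])%N.
Proof.
have [x -> xp] := ffact_mulp i.
have p_gt0 := prime_gt0 p_pr.
rewrite fact_prime mulnCA -!mulnA expnS expn1.
rewrite -!muln_modr; congr muln.
by rewrite -modnMml bin_mulp modnMml mulnA -modnMmr xp modnMmr mulnC.
Qed.

(** If p does not divide r, the binomial and the falling factorial each give one p. Otherwise r > p,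
    the falling factorial contains r! = r (r-1)!, and p divides both factors. *)
Lemma bin_ffact_mulp0 l i r : (0 < r)%N -> r != p ->
  (p ^ 2 %| 'C(l * p, r) * (i * p) ^_ r)%N.
Proof.
move=> r_gt0 np.
have dvd_ffact := dvdn_ffact_mul p i r_gt0.
have [dvd|ndvd] := boolP (p %| r)%N; last first.
  rewrite expnS expn1 dvdn_mul //.
  have := mul_bin_diag (l * p) r.-1; rewrite prednK // => e.
  have : (p %| r * 'C(l * p, r))%N by rewrite -e dvdn_mulr ?dvdn_mull.
  by rewrite Euclid_dvdM // (negPf ndvd).
apply: dvdn_mull; rewrite -bin_ffact; apply: dvdn_mull.
have lt_pr : (p < r)%N by rewrite ltn_neqAle eq_sym np dvdn_leq.
rewrite -(prednK r_gt0) factS (prednK r_gt0) expnS expn1 dvdn_mul //.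
by rewrite dvdn_fact // prime_gt0 //= -ltnS (prednK r_gt0).
Qed.

End FactorialModp.

Definition divisible (V : zmodType) (m : nat) (x : V) : Prop := exists y, x = y *+ m.

Section Divisible.
Variables (V : zmodType) (m : nat).
Implicit Types x y : V.

Lemma divisible0 : divisible m (0 : V).
Proof. by exists 0; rewrite mul0rn. Qed.

Lemma divisibleMn x : divisible m (x *+ m).
Proof. by exists x. Qed.

Lemma divisibleD x y : divisible m x -> divisible m y -> divisible m (x + y).
Proof. by move=> [a ->] [b ->]; exists (a + b); rewrite mulrnDl. Qed.

Lemma divisibleB x y : divisible m x -> divisible m y -> divisible m (x - y).
Proof. by move=> [a ->] [b ->]; exists (a - b); rewrite mulrnBl. Qed.

Lemma divisible_sum (I : Type) (r : seq I) (P : pred I) (F : I -> V) :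
  (forall i, P i -> divisible m (F i)) -> divisible m (\sum_(i <- r | P i) F i).
Proof.
by move=> dF; apply: (big_ind (divisible m)) => //; [exact: divisible0 | exact: divisibleD].
Qed.

Lemma divisible_dvdn x k : (m %| k)%N -> divisible m (x *+ k).
Proof. by case/dvdnP => l ->; exists (x *+ l); rewrite mulrnA. Qed.

Lemma divisible_modn x k l : (k = l %[mod m])%N -> divisible m (x *+ k - x *+ l).
Proof.
move=> e; rewrite (divn_eq k m) (divn_eq l m) e !mulrnDr opprD addrACA subrr addr0.
by apply: divisibleB; apply: divisible_dvdn; rewrite dvdn_mull.
Qed.

End Divisible.

Lemma divisibleMl (B : nzRingType) m (x y : B) : divisible m y -> divisible m (x * y).
Proof. by case=> z ->; exists (x * z); rewrite mulrnAr. Qed.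

Lemma divisible_mulrn (V : zmodType) m k (x : V) :
  divisible m x -> divisible (m * k) (x *+ k).
Proof. by case=> z ->; exists z; rewrite mulrnA. Qed.

Lemma divisible_morph (V W : zmodType) (f : V -> W) m x :
  {morph f : x y / x - y} -> divisible m x -> divisible m (f x).
Proof. by move=> /subr_morphE[_ _ _ fMn] [z ->]; exists (f z); rewrite fMn. Qed.

Section Flip.
Variable R : comNzRingType.
Local Notation W := (wpoly R).

(** The exchange involution read on symbols: it reverses the factors, fixes u and negates v. *)
Definition wflip (P : W) : W :=
  bisum (fun i j c => wmon c 0 0 * ((- wL R) ^+ j * wX R ^+ i)) P.

Lemma wflipB : {morph wflip : P Q / P - Q}.
Proof. by apply: bisumB => i j c d /=; rewrite wmonB mulrBl. Qed.

Lemma wmon0 i j : wmon 0 i j = 0 :> W.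
Proof. by have [-> _ _ _] := subr_morphE (@wmonB R i j). Qed.

Lemma wflip_mon c i j :
  wflip (wmon c i j) = wmon c 0 0 * ((- wL R) ^+ j * wX R ^+ i).
Proof. by rewrite /wflip bisum_bimon // => k l; rewrite wmon0 mul0r. Qed.

End Flip.

Section Commutators.
Variable R : comNzRingType.
Local Notation W := (wpoly R).
Variable p : nat.
Hypothesis p_pr : prime p.

Lemma wLX_modp l k :
  divisible p (wL R ^+ l * wX R ^+ (k * p) - wX R ^+ (k * p) * wL R ^+ l).
Proof.
rewrite (normal_order (wLX R)) big_ord_recl /= bin0 ffactn0 mulr1n !subn0 addrAC subrr.
rewrite add0r; apply: divisible_sum => i _; apply: divisible_dvdn.
by rewrite dvdn_mull // dvdn_ffact_mul.
Qed.

(** In the normal ordering of v^(lp) u^(ip), the term r = 0 gives the commutative product, r = p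
    gives half of a Poisson bracket, and all others vanish modulo p^2. If l i = 0 the truncated
    exponents have coefficient 0. *)
Lemma commXL_modp2 k l i j :
  divisible (p ^ 2)
    ((wX R ^+ (k * p) * wL R ^+ (l * p)) * (wX R ^+ (i * p) * wL R ^+ (j * p))
     - wX R ^+ ((k + i) * p) * wL R ^+ ((l + j) * p)
     - (wX R ^+ ((k + i).-1 * p) * wL R ^+ ((l + j).-1 * p)) *+ (p`! * (l * i))).
Proof.
have p_gt0 := prime_gt0 p_pr.
pose F r := wX R ^+ (k * p) * (wX R ^+ (i * p - r) * wL R ^+ (l * p - r)) * wL R ^+ (j * p).
pose c r := ('C(l * p, r) * (i * p) ^_ r)%N.
(* The range is lengthened by p so that the index r = p exists even for l = 0; the added binomials
   are 0. *)
have -> : (wX R ^+ (k * p) * wL R ^+ (l * p)) * (wX R ^+ (i * p) * wL R ^+ (j * p))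
    = \sum_(r < (l * p + p).+1) F r *+ c r.
  rewrite -mulrA [wL R ^+ _ * (_ * _)]mulrA mulrA (normal_order (wLX R)).
  rewrite mulr_sumr mulr_suml.
  rewrite (big_ord_widen (l * p + p).+1 (fun r =>
    wX R ^+ (k * p) * ((wX R ^+ (i * p - r) * wL R ^+ (l * p - r)) *+ c r)
    * wL R ^+ (j * p))) ?ltnS ?leq_addr //.
  rewrite big_mkcond /=; apply: eq_bigr => r _; case: ltnP => [_|ltr].
    by rewrite mulrnAr mulrnAl.
  by rewrite /c bin_small // mul0n mulr0n.
have F0 : F 0%N *+ c 0%N = wX R ^+ ((k + i) * p) * wL R ^+ ((l + j) * p).
  by rewrite /c bin0 ffactn0 mulr1n /F !subn0 !mulnDl !exprD !mulrA.
rewrite big_ord_recl /= F0 [X in X - _ - _]addrC addrK.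
have lt1 : (p.-1 < l * p + p)%N by lia.
rewrite (bigD1 (Ordinal lt1)) //= /bump /= add1n (prednK p_gt0) addrAC.
apply: divisibleD; last first.
  apply: divisible_sum => r nr; apply: divisible_dvdn.
  rewrite add1n; apply: bin_ffact_mulp0 => //.
  by apply: contra nr => /eqP e; apply/eqP/val_inj => /=; clear -e; lia.
have [li0|li_gt0] := posnP (l * i).
  rewrite li0 muln0 mulr0n subr0 (_ : c p = 0%N) ?mulr0n; first exact: divisible0.
  have [e|e] : l = 0%N \/ i = 0%N by case: (l) (i) li0 => [|?] [|?]; auto.
    by rewrite /c e mul0n bin0n gtn_eqF.
  by rewrite /c e mul0n ffact0n gtn_eqF // muln0.
have [l_gt0 i_gt0] : (0 < l)%N /\ (0 < i)%N by move: li_gt0; rewrite muln_gt0 => /andP.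
have -> : F p = wX R ^+ ((k + i).-1 * p) * wL R ^+ ((l + j).-1 * p).
  case: l i l_gt0 i_gt0 @F @c F0 li_gt0 lt1 => // l [//|i] _ _ F c _ _ _; rewrite /F.
  by rewrite addnS addSn /= !mulSn !addKn !mulnDl !exprD !mulrA.
by apply: divisible_modn; apply: bin_ffact_mulp.
Qed.

End Commutators.

(** * Polynomials in u^p and v^p and their brackets *)

Section CenterPart.
Variables (R : comNzRingType) (p D : nat).
Hypothesis p_gt0 : (0 < p)%N.
Local Notation W := (wpoly R).
Implicit Types P : W.

Definition center_mon (c : R) (q : 'I_D * 'I_D) : W := wmon c (q.1 * p) (q.2 * p).

Definition center_part P : W :=
  \sum_(q : 'I_D * 'I_D) center_mon (wcoef P (q.1 * p) (q.2 * p)) q.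

Lemma wcoef_center_sum (c : 'I_D * 'I_D -> R) i j :
  wcoef (\sum_(q : 'I_D * 'I_D) center_mon (c q) q) i j
  = \sum_(q : 'I_D * 'I_D) c q *+ ((i, j) == (q.1 * p, q.2 * p)%N).
Proof.
by rewrite wcoef_sum; apply: eq_bigr => q _; rewrite wcoef_mon -mulrnA mulnb.
Qed.

Lemma wcoef_center_sum_mul (c : 'I_D * 'I_D -> R) (q : 'I_D * 'I_D) :
  wcoef (\sum_(q : 'I_D * 'I_D) center_mon (c q) q) (q.1 * p) (q.2 * p) = c q.
Proof.
rewrite wcoef_center_sum (bigD1 q) //= eqxx mulr1n big1 ?addr0 // => q' nq.
case: eqP => // -[/eqP e1 /eqP e2]; case/eqP: nq.
rewrite !eqn_pmul2r // in e1 e2; case: q q' e1 e2 => [a b] [a' b'] /= /eqP e1 /eqP e2.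
by congr (_, _); apply: val_inj.
Qed.

End CenterPart.

Section Divisibility.
Variables (R : comNzRingType) (m : nat).

Lemma wdivisible (P : wpoly R) :
  (forall i j, divisible m (wcoef P i j)) <-> divisible m P.
Proof.
split=> [dP|dP i j]; last first.
  by apply: (@divisible_morph _ _ (fun P : wpoly R => wcoef P i j)) => //; apply: wcoefB.
rewrite (wpoly_sum P); apply: divisible_sum => i _; apply: divisible_sum => j _.
exact: (@divisible_morph _ _ (fun c => wmon c i j)) (wmonB i j) (dP i j).
Qed.

End Divisibility.

Section ModularCenter.
Variables (R S : comNzRingType) (n : nat) (f : {rmorphism R -> S}).
Local Notation p := n.+1.
Hypotheses (p_pr : prime p) (charS : p%:R = 0 :> S).
Hypothesis kerf : forall r, f r = 0 -> divisible p r.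
Local Notation W := (wpoly R).
Local Notation M := {poly {poly R}}.
Implicit Types P : W.

Lemma mx_model_divisible P : mx_model n f P = 0 <-> divisible p P.
Proof.
split=> [P0|[E ->]].
  by apply/wdivisible => i j; apply: kerf; apply: mx_model_eq0 P0 _ _.
have [_ _ _ ->] := subr_morphE (@mx_modelB _ n _ f).
by apply/matrixP => i j; rewrite mulmxnE -mulr_natr pchar_bipoly0 // mulr0 mxE.
Qed.



Definition wcentral P := exists m, mx_model n f P = m%:M.

Lemma wcentral_comm P E : wcentral P -> divisible p (E * P - P * E).
Proof.
case=> m Pm; apply/mx_model_divisible.
by rewrite mx_modelB !mx_modelM // Pm [X in X - _]scalar_mxC subrr.
Qed.

(** Centrality kills, modulo p, every exponent not divisible by p; the degree bound kills the
    multiples of p from D p on. *)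
Lemma center_part_mod D a P : (a < D)%N -> wcentral P ->
    (forall i j, (p * a < i)%N || (p * a < j)%N -> wcoef P i j = 0) ->
  divisible p (P - center_part p D P).
Proof.
move=> lta [m Pm] bndP; apply/wdivisible => i j; rewrite wcoefB.
have [/andP[/dvdnP[k ->] /dvdnP[l ->]]|nd] := boolP ((p %| i) && (p %| j))%N.
  have [ltk|lek] := ltnP k D; last first.
    rewrite bndP ?wcoef_center_sum; last by rewrite mulnC ltn_pmul2r ?(leq_trans lta).
    rewrite big1 ?subr0; first exact: divisible0.
    move=> q _; rewrite xpair_eqE eqn_pmul2r // gtn_eqF ?mulr0n //.
    exact: leq_trans (ltn_ord _) lek.
  have [ltl|lel] := ltnP l D; last first.
    rewrite bndP ?wcoef_center_sum; last first.
      by rewrite orbC mulnC ltn_pmul2r ?(leq_trans lta).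
    rewrite big1 ?subr0; first exact: divisible0.
    move=> q _; rewrite xpair_eqE eqn_pmul2r // andbC eqn_pmul2r // gtn_eqF ?mulr0n //.
    exact: leq_trans (ltn_ord _) lel.
  have := wcoef_center_sum_mul (ltn0Sn n)
    (fun q : 'I_D * 'I_D => wcoef P (q.1 * p) (q.2 * p)) (Ordinal ltk, Ordinal ltl).
  by rewrite /center_part /= => ->; rewrite subrr; apply: divisible0.
rewrite wcoef_center_sum big1 ?subr0; first exact/kerf/(mx_model_scalar p_pr charS Pm).
move=> q _; case: eqP => // -[ei ej].
by rewrite ei ej !dvdn_mull in nd.
Qed.

End ModularCenter.

Lemma subrBB (V : zmodType) (a b c x y : V) :
  (a - c - x) - (b - c - y) = a - b - (x - y).
Proof.
by rewrite [in LHS]opprD opprK addrACA opprB [a - c + _]addrA subrK opprB [- x + y]addrC.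
Qed.

Section Jacobian.
Variables (R : comNzRingType) (p D : nat).
Hypothesis p_pr : prime p.
Local Notation W := (wpoly R).
Local Notation X := (wX R).
Local Notation L := (wL R).

Lemma wmon_mul c d i j k l :
  wmon c i j * wmon d k l
  = wmon (c * d) 0 0 * ((X ^+ i * L ^+ j) * (X ^+ k * L ^+ l)).
Proof.
rewrite (wmon_split c) (wmon_split d) mulrA -[_ * wmon d 0 0]mulrA -(wmonC d).
by rewrite -wmonM -!mulrA.
Qed.

Let Z (q q' : 'I_D * 'I_D) : W :=
  X ^+ ((q.1 + q'.1).-1 * p) * L ^+ ((q.2 + q'.2).-1 * p).

Let comm_mon c d (q q' : 'I_D * 'I_D) :
  divisible (p ^ 2)
    (center_mon p c q * center_mon p d q' - center_mon p d q' * center_mon p c q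
     - wmon (c * d) 0 0 * (Z q q' *+ (p`! * (q.2 * q'.1)) - Z q q' *+ (p`! * (q.1 * q'.2)))).
Proof.
rewrite /center_mon !wmon_mul [d * c]mulrC -mulrBr -mulrBr; apply: divisibleMl.
have h1 := commXL_modp2 R p_pr q.1 q.2 q'.1 q'.2.
have h2 := commXL_modp2 R p_pr q'.1 q'.2 q.1 q.2.
move: h1 h2; rewrite [(q'.1 + _)%N]addnC [(q'.2 + _)%N]addnC [(q'.2 * q.1)%N]mulnC.
rewrite -/(Z q q') => h1 h2; by have := divisibleB h1 h2; rewrite subrBB.
Qed.


Definition bracket_coef (v w : nat -> nat -> R) (a b : nat) : R :=
  \sum_(q : 'I_D * 'I_D * ('I_D * 'I_D)
     | (q.1.1 + q.2.1 == a.+1)%N && (q.1.2 + q.2.2 == b.+1)%N)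
    v q.1.1 q.1.2 * w q.2.1 q.2.2 * ((q.1.2 * q.2.1)%:R - (q.1.1 * q.2.2)%:R).

(** The commutative products cancel in G H - H G, and the two terms with r = p leave p! (l i - k j):
    modulo p^2 the commutator is p! times the Jacobian. *)
Lemma comm_center_sum (v w : nat -> nat -> R) a b :
  let G := \sum_(q : 'I_D * 'I_D) center_mon p (v q.1 q.2) q in
  let H := \sum_(q : 'I_D * 'I_D) center_mon p (w q.1 q.2) q in
  divisible (p ^ 2)
    (wcoef (G * H - H * G) (a * p) (b * p) - bracket_coef v w a b *+ p`!).
Proof.
have p_gt0 := prime_gt0 p_pr.
move=> G H; pose T (q : 'I_D * 'I_D * ('I_D * 'I_D)) : W :=
  wmon (v q.1.1 q.1.2 * w q.2.1 q.2.2) 0 0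
  * (Z q.1 q.2 *+ (p`! * (q.1.2 * q.2.1)) - Z q.1 q.2 *+ (p`! * (q.1.1 * q.2.2))).
have dT : divisible (p ^ 2) (G * H - H * G - \sum_q T q).
  rewrite /G /H !mulr_suml.
  under eq_bigr do rewrite mulr_sumr.
  under [X in _ - X - _]eq_bigr do rewrite mulr_sumr.
  rewrite [X in _ - X - _]exchange_big /= !pair_bigA -!sumrB /=.
  by apply: divisible_sum => q _; apply: comm_mon.
have := (wdivisible _ _).2 dT (a * p)%N (b * p)%N; rewrite wcoefB.
suff -> : wcoef (\sum_q T q) (a * p) (b * p) = bracket_coef v w a b *+ p`! by [].
rewrite wcoef_sum /bracket_coef -sumrMnl [RHS]big_mkcond /=; apply: eq_bigr => q _.
rewrite wcoefCM wcoefB !wcoefMn /Z -wmonXL wcoef_mon !eqn_pmul2r //.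
(* Truncated predecessors would misplace the terms with k + i = 0 or l + j = 0, but there l i and k
   j are both 0. *)
have [k0|k_gt0] := posnP (q.1.1 + q.2.1).
  have [-> ->] : (q.1.1 = 0%N :> nat) /\ (q.2.1 = 0%N :> nat) by lia.
  by rewrite ?mul0n !muln0 !mulr0n subrr !mulr0 mul0rn; case: (_ && _).
have [l0|l_gt0] := posnP (q.1.2 + q.2.2).
  have [-> ->] : (q.1.2 = 0%N :> nat) /\ (q.2.2 = 0%N :> nat) by lia.
  by rewrite ?mul0n !muln0 !mulr0n subrr !mulr0 mul0rn; case: (_ && _).
have -> : (a == (q.1.1 + q.2.1).-1)%N = (q.1.1 + q.2.1 == a.+1)%N by lia.
have -> : (b == (q.1.2 + q.2.2).-1)%N = (q.1.2 + q.2.2 == b.+1)%N by lia.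
case: (_ == a.+1)%N; last by rewrite !mulr0n !mul0rn subrr mulr0.
case: (_ == b.+1)%N; last by rewrite !mulr0n !mul0rn subrr mulr0.
by rewrite !mulr1n ![(p`! * _)%N]mulnC !mulrnA -mulrnBl mulrnAr.
Qed.

End Jacobian.

Lemma coef_exp_top (R : nzRingType) (q : {poly R}) m l :
  (size q <= l.+1)%N -> (size (q ^+ m) <= (m * l).+1)%N /\ (q ^+ m)`_(m * l) = q`_l ^+ m.
Proof.
move=> leq; elim: m => [|m [IHs IHc]].
  by rewrite !expr0 size_poly1 coef1.
rewrite !exprS mulSn; split.
  by rewrite (leq_trans (size_polyMleq _ _)) //; lia.
rewrite coefM (bigD1 (inord l)) //= inordK ?ltnS ?leq_addr // addKn IHc big1 ?addr0 //.
move=> i ni; have [lti|gti|ei] := ltngtP i l.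
- by rewrite [X in _ * X]nth_default ?mulr0 // (leq_trans IHs) //; lia.
- by rewrite nth_default ?mul0r // (leq_trans leq).
- by case/eqP: ni; apply: val_inj; rewrite /= inordK ?ltnS ?leq_addr.
Qed.

Lemma subrACA (Z : zmodType) (x y z t : Z) :
  (x - y) - (z - t) = (x - z) - (y - t).
Proof. by rewrite !opprD !opprK addrACA. Qed.

(** * The leading coefficient of V modulo one prime *)

Section ModularStep.
Variables (R S : comNzRingType) (n : nat) (f : {rmorphism R -> S}).
Local Notation p := n.+1.
Hypotheses (p_pr : prime p) (p_odd : odd p) (charS : p%:R = 0 :> S).
Hypotheses (kerf : forall r, f r = 0 -> divisible p r)
  (p_reg : forall r : R, r *+ p = 0 -> r = 0).
Variable Q : {pred R}.
Hypotheses (Q0 : 0 \in Q) (QB : {in Q &, forall x y, x - y \in Q})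
  (QM : forall r x, x \in Q -> r * x \in Q)
  (Qprime : forall x y, x * y \in Q -> (x \in Q) || (y \in Q))
  (Q1 : 1 \notin Q) (Qp : p%:R \in Q).
Local Notation W := (wpoly R).
Local Notation M := {poly {poly R}}.
Variables (U V : W) (a : nat).
Hypotheses (VU : V * U - U * V = 1)
  (sizeU : (size (U : M) <= a.+1)%N) (sizeV : (size (V : M) <= a.+1)%N)
  (innerU : inner_le a U) (innerV : inner_le a V)
  (flipU : wflip (U ^+ p) = U ^+ p) (flipV : wflip (V ^+ p) = - V ^+ p).
Local Notation D := a.+2.
Hypothesis lt_DDp : (D * D < p)%N.

Lemma divisible_Q r : divisible p r -> r \in Q.
Proof. by case=> s ->; rewrite -mulr_natr QM. Qed.

Lemma natr_Q m : (0 < m < p)%N -> m%:R \notin Q.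
Proof.
case/andP=> m_gt0 ltm; apply: contra Q1 => Qm.
have : coprime m p.
  rewrite coprime_sym prime_coprime //; apply/negP => /(dvdn_leq m_gt0).
  by rewrite leqNgt ltm.
case: m m_gt0 Qm {ltm} => // m _ Qm /coprimeP -/(_ isT)[[u v] /= uv].
have lt : (v * p <= u * m.+1)%N by lia.
by rewrite -[1]/(1%:R) -uv natrB // !natrM QB // QM.
Qed.

Lemma fact_Q m : (m < p)%N -> m`!%:R \notin Q.
Proof.
elim: m => [|m IH] ltm //; rewrite factS natrM.
by apply/negP => /Qprime; rewrite (negPf (IH (ltnW ltm))) orbF; apply/negP/natr_Q.
Qed.

Let center (P : W) k l := wcoef P (k * p) (l * p).

Lemma wexp_bound (P : W) : (size (P : M) <= a.+1)%N -> inner_le a P ->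
  forall i j, (p * a < i)%N || (p * a < j)%N -> wcoef (P ^+ p) i j = 0.
Proof.
move=> leP innP i j; have [les _] := wexp_lead p leP; have inn := inner_le_exp p innP.
case/orP=> lt; rewrite /wcoef; last by rewrite nth_default // (leq_trans (inn i)).
by rewrite (nth_default _ (leq_trans les lt)) coef0.
Qed.

Lemma center_bound (P : W) : (size (P : M) <= a.+1)%N -> inner_le a P ->
  forall k l, center (P ^+ p) k l \notin Q -> (k < D)%N && (l < D)%N.
Proof.
move=> leP innP k l; apply: contraR; rewrite negb_and -!leqNgt => h.
rewrite /center wexp_bound // ![(p * a)%N]mulnC !ltn_pmul2r //.
by case/orP: h => h; apply/orP; [left|right]; apply: leq_trans h.
Qed.

Let sg (Z : zmodType) (b : bool) (x : Z) : Z := if b then - x else x.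

Let sgB (Z : zmodType) b : {morph @sg Z b : x y / x - y}.
Proof. by case: b => x y //; rewrite /sg opprB opprK addrC. Qed.

(** Modulo p the reversed factors commute, and (-1)^(lp) = (-1)^l because p is odd. *)
Lemma wflip_center_mon (c : R) (q : 'I_D * 'I_D) :
  divisible p (center_mon p (sg (odd q.2) c) q - wflip (center_mon p c q)).
Proof.
rewrite /center_mon wflip_mon.
have -> : (- wL R) ^+ (q.2 * p) = sg (odd q.2) (wL R ^+ (q.2 * p)).
  by rewrite exprNn -signr_odd oddM p_odd andbT; case: odd; rewrite ?mul1r ?mulN1r.
have -> : wmon (sg (odd q.2) c) (q.1 * p) (q.2 * p)
    = wmon c 0 0 * sg (odd q.2) (wX R ^+ (q.1 * p) * wL R ^+ (q.2 * p)).
  case: odd; rewrite /sg wmon_split // mulrN.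
  by have [_ wmonN _ _] := subr_morphE (@wmonB R 0 0); rewrite wmonN mulNr.
rewrite -mulrBr; apply: divisibleMl.
have := wLX_modp R p (q.2 * p) q.1; case: odd; rewrite /sg.
  by rewrite mulNr opprK addrC.
by move=> h; rewrite -opprB; have := divisibleB (divisible0 _ _) h; rewrite sub0r.
Qed.

(** Flipping P and its central part shows that twice this coefficient is divisible by p when the
    parity of l disagrees with the sign [e]; and 2 is outside Q since p > 2. *)
Lemma wflip_center (P : W) (e : bool) k l : wcentral n f P ->
    (forall i j, (p * a < i)%N || (p * a < j)%N -> wcoef P i j = 0) ->
    wflip P = sg e P -> odd l != e -> center P k l \in Q.
Proof.
move=> cP bndP flipP le.
have p_gt2 : (2 < p)%N by have := lt_DDp; lia.
have [ltk|lek] := ltnP k D; last first.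
  by rewrite /center bndP // mulnC ltn_pmul2r // (leq_trans _ lek).
have [ltl|lel] := ltnP l D; last first.
  by rewrite /center bndP // orbC mulnC ltn_pmul2r // (leq_trans _ lel).
have dG := center_part_mod p_pr charS kerf (ltnW (ltnSn a.+1)) cP bndP.
pose c (q : 'I_D * 'I_D) := wcoef P (q.1 * p) (q.2 * p).
have A1 : divisible p (\sum_(q : 'I_D * 'I_D) center_mon p (sg (odd q.2) (c q)) q
    - wflip (center_part p D P)).
  have [wflip0 _ wflipD _] := subr_morphE (@wflipB R).
  rewrite (big_morph _ wflipD wflip0) -sumrB.
  by apply: divisible_sum => q _; apply: wflip_center_mon.
have A2 := divisible_morph (@wflipB R) dG.
rewrite wflipB flipP in A2.
have A3 := divisible_morph (@sgB W e) dG; rewrite sgB in A3.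
have := divisibleD (divisibleB A1 A2) A3.
rewrite opprB [X in divisible _ (X + _)]addrA subrK addrA subrK.
have -> : sg e (center_part p D P) = \sum_(q : 'I_D * 'I_D) center_mon p (sg e (c q)) q.
  have [sg0 _ sgD _] := subr_morphE (@sgB W e).
  rewrite (big_morph _ sgD sg0); apply: eq_bigr => q _.
  have [_ wmonN _ _] := subr_morphE (@wmonB R (q.1 * p) (q.2 * p)).
  by case: (e); rewrite /sg // /center_mon wmonN.
rewrite -sumrB => /wdivisible/(_ (k * p)%N (l * p)%N).
under eq_bigr do rewrite /center_mon -wmonB.
have := wcoef_center_sum_mul (ltn0Sn n) (fun q : 'I_D * 'I_D =>
  sg (odd q.2) (c q) - sg e (c q)) (Ordinal ltk, Ordinal ltl).
rewrite /= => -> /divisible_Q; rewrite /c /= -/(center P k l).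
have Q2 x : x *+ 2 \in Q -> x \in Q.
  rewrite -mulr_natr => /Qprime/orP[] //.
  by rewrite (negPf (natr_Q _)) //= p_gt2.
case: (odd l) (e) le => [] [] // _; rewrite /sg.
  by rewrite -opprD -mulr2n => h; apply: Q2; rewrite -[_ *+ 2]opprK -sub0r QB.
by rewrite opprK -mulr2n; apply: Q2.
Qed.

(* Modulo p, V^p and U^p are polynomials in u^p and v^p whose Jacobian is 1, because
   [V^p, U^p] = p! modulo p^2. *)
Lemma modular_step k l : (0 < k)%N ->
    (size (V : M) <= k.+1)%N -> (size ((V : M)`_k)%R <= l.+1)%N ->
  wcoef V k l \in Q.
Proof.
move=> k_gt0 sizeVk sizeVkl.
have [mV cV] : wcentral n f (V ^+ p).
  have NV : (- U) * V - V * (- U) = 1 by rewrite mulNr mulrN opprK addrC.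
  exact: (@mx_model_expr _ _ p_pr charS _ f V (- U) NV).
have [mU cU] := mx_model_expr p_pr charS f VU.
have bV := wexp_bound sizeV innerV; have bU := wexp_bound sizeU innerU.
(* The coefficient of u^(kp) v^(lp) in V^p is the p-th power of the corner coefficient of V, and Q
   is prime. *)
have : center (V ^+ p) k l \in Q; last first.
  have [_] := wexp_lead p sizeVk; have [_] := coef_exp_top p sizeVkl.
  rewrite /center /wcoef [(k * p)%N]mulnC [(l * p)%N]mulnC => e1 ->.
  rewrite e1; elim: {1}p => [|m IH]; first by rewrite expr0 (negPf Q1).
  by rewrite exprS => /Qprime/orP[//|/IH].
have lt_aD : (a < D)%N by [].
have dV := center_part_mod p_pr charS kerf lt_aD (ex_intro _ mV cV) bV.
have dU := center_part_mod p_pr charS kerf lt_aD (ex_intro _ mU cU) bU.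
set G := center_part p D (V ^+ p) in dV; set H := center_part p D (U ^+ p) in dU.
have p_gt0 : (0 < p)%N by [].
(* Normal ordering applied to the pair (U, V): index 0 is U^p V^p, index p is p!, and in between the
   binomial and the falling factorial each contribute one p. *)
have commVU : divisible (p ^ 2) (V ^+ p * U ^+ p - U ^+ p * V ^+ p - 1 *+ p`!).
  rewrite (normal_order VU) big_ord_recl /= bin0 ffactn0 mulr1n !subn0 addrAC.
  rewrite big_ord_recr /= /bump /= add1n binn ffactnn mul1n subnn !expr0 mulr1.
  rewrite addrA addrK addrAC subrr add0r.
  apply: divisible_sum => i _; apply: divisible_dvdn; rewrite add1n.
  have lti : (i.+1 < p)%N by rewrite ltnS.
  rewrite expnS expn1 dvdn_mul ?prime_dvd_bin //.
  by have := @dvdn_ffact_mul p 1 i.+1 isT; rewrite mul1n.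
have cG : wcentral n f G.
  exists mV; rewrite -cV; apply/esym/eqP; rewrite -subr_eq0 -mx_modelB.
  exact/eqP/mx_model_divisible.
(* With V^p = G + p E1 and U^p = H + p E2 the difference is p [E1, U^p] - p [E2, G]. U^p and G are
   central modulo p, so each bracket yields a second factor p. *)
have commGH : divisible (p ^ 2)
    ((V ^+ p * U ^+ p - U ^+ p * V ^+ p) - (G * H - H * G)).
  have [E1 eE1] := dV; have [E2 eE2] := dU.
  have -> : (V ^+ p * U ^+ p - U ^+ p * V ^+ p) - (G * H - H * G)
      = (E1 * U ^+ p - U ^+ p * E1) *+ p - (E2 * G - G * E2) *+ p.
    rewrite !mulrnBl -(mulrnAl E1) -(mulrnAl E2) -(mulrnAr _ E1) -(mulrnAr _ E2).
    rewrite -eE1 -eE2 !mulrBl !mulrBr.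
    rewrite [X in _ = X - _]subrACA [X in _ = _ - X]subrACA.
    rewrite -[X in _ = _ - (X - _)]opprB -[X in _ = _ - (_ - X)]opprB opprK.
    by rewrite [X in _ = _ - X]addrC [X in _ = _ + X]opprB addrA subrK.
  rewrite expnS expn1; apply: divisibleB; apply: divisible_mulrn.
    exact: (wcentral_comm p_pr charS kerf _ (ex_intro _ mU cU)).
  exact: (wcentral_comm p_pr charS kerf _ cG).
apply: (@polygon R Q D Q0 QB QM Qprime _ (center (V ^+ p)) (center (U ^+ p))) k_gt0.
- by move=> m /andP[m_gt0 lem]; rewrite natr_Q // m_gt0 (leq_ltn_trans lem).
- exact: center_bound sizeV innerV.
- exact: center_bound sizeU innerU.
- by move=> i j oj; apply: (@wflip_center _ true _ _ _ bV); rewrite ?(negPf oj) //; exists mV.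
- by move=> i j oj; apply: (@wflip_center _ false _ _ _ bU); rewrite ?oj //; exists mU.
2: by [].
move=> a0 b0; change (bracket_coef D (center (V ^+ p)) (center (U ^+ p)) a0 b0
  - ((a0 == 0) && (b0 == 0))%N%:R \in Q).
set x := _ - _.
have : divisible (p ^ 2) (x *+ p`!).
  have h1 := divisibleB commVU commGH; rewrite subrACA subrr sub0r opprB in h1.
  have h2 := (wdivisible _ _).2 h1 (a0 * p)%N (b0 * p)%N.
  have h3 := comm_center_sum D p_pr (center (V ^+ p)) (center (U ^+ p)) a0 b0.
  have := divisibleB h2 h3; congr divisible.
  rewrite wcoefB subrACA subrr sub0r opprB wcoefMn.
  have -> : wcoef (1 : W) (a0 * p) (b0 * p) = ((a0 == 0) && (b0 == 0))%N%:R.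
    by rewrite (wcoef_mon 1 0 0) -mulrnA mulnb !muln_eq0 !orbF.
  by rewrite /x mulrnBl.
(* Regularity of p removes one factor p, and the remaining (p-1)! is outside Q. *)
rewrite (fact_prime p_pr) expnS expn1 => -[y e].
have {e} e : x *+ p.-1`! = y *+ p.
  apply/eqP; rewrite -subr_eq0; apply/eqP/p_reg.
  by rewrite mulrnBl -!mulrnA [(_`! * _)%N]mulnC e subrr.
have : x * p.-1`!%:R \in Q by rewrite mulr_natr e -mulr_natr QM.
by move/Qprime/orP => [//|]; rewrite (negPf (fact_Q _)).
Qed.

End ModularStep.

(** * Reduction modulo a prime *)

Section PrimeAvoiding.
Import classical_sets.
Local Open Scope classical_set_scope.
Local Open Scope ring_scope.

Variables (R : comNzRingType) (p : nat) (z : R).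
Hypothesis npz : forall m, ~ divisible p (z ^+ m).

Let avoiding_ideal (A : R -> Prop) : Prop :=
  [/\ forall x y, A x -> A y -> A (x - y), forall r x, A x -> A (r * x),
      A p%:R & forall m, ~ A (z ^+ m)].

Let avoiding_chain (F : set (set R)) :
    F `<=` [set A | A = set0 \/ avoiding_ideal A] -> total_on F subset ->
  [set A | A = set0 \/ avoiding_ideal A] (\bigcup_(X in F) X).
Proof.
move=> FP totF; have idF X x : F X -> X x -> avoiding_ideal X.
  by move=> FX Xx; have [X0|//] := FP _ FX; rewrite X0 in Xx.
have [[X FX iX]|nF] := pselect (exists2 X, F X & avoiding_ideal X); last first.
  left; apply/seteqP; split=> // x [X FX Xx]; case: nF.
  by exists X => //; apply: idF Xx.
right; split.
- move=> x y [Y FY Yx] [Y' FY' Yy]; have [sub|sub] := totF _ _ FY FY'.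
    by exists Y' => //; have [YB _ _ _] := idF _ _ FY' Yy; apply: YB => //; apply: sub.
  by exists Y => //; have [YB _ _ _] := idF _ _ FY Yx; apply: YB => //; apply: sub.
- by move=> r x [Y FY Yx]; exists Y => //; have [_ YM _ _] := idF _ _ FY Yx; apply: YM.
- by exists X => //; have [_ _ Xp _] := iX.
- by move=> m [Y FY Yz]; have [_ _ _ /(_ m)] := idF _ _ FY Yz.
Qed.

(** An ideal maximal among those containing p and no power of z is prime: if x and y lie outside,
    adjoining either one captures a power of z, and the product of these two powers would lie in the
    ideal if x y did. *)
Lemma prime_ideal_avoiding : exists Q : {pred R},
  [/\ [/\ 0 \in Q, {in Q &, forall x y, x - y \in Q} &
        forall r x, x \in Q -> r * x \in Q],
      forall x y, x * y \in Q -> (x \in Q) || (y \in Q),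
      p%:R \in Q & z \notin Q].
Proof.
have [A [PA maxA]] := Zorn_bigcup avoiding_chain.
have ipR : avoiding_ideal (fun x => divisible p x).
  split=> [x y||| //]; [exact: divisibleB | by move=> r x; apply: divisibleMl |].
  exact: divisibleMn.
have [AB AM Ap Az] : avoiding_ideal A.
  case: PA => // A0; case: (maxA (fun x => divisible p x)); last by right.
  by rewrite A0; split=> // /(_ 0) []; apply: divisible0.
have A0 : A 0 by rewrite -(subrr p%:R); apply: AB.
have AD x y : A x -> A y -> A (x + y).
  by move=> Ax Ay; rewrite -[y]opprK; rewrite -[- y]sub0r; apply: (AB _ _ Ax (AB _ _ A0 Ay)).
have grow x : ~ A x -> exists m a r, A a /\ z ^+ m = a + r * x.
  move=> nAx; pose B y := exists2 a, A a & exists r, y = a + r * x.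
  have subAB : A `<=` B by move=> y Ay; exists y => //; exists 0; rewrite mul0r addr0.
  have Bx : B x by exists 0 => //; exists 1; rewrite mul1r add0r.
  apply: contrapT => nz; case: (maxA B).
    by split=> // sub; apply: nAx; apply: sub.
  right; split.
  - move=> _ _ [a Aa [r ->]] [b Ab [s ->]]; exists (a - b); first exact: AB.
    by exists (r - s); rewrite mulrBl opprD addrACA.
  - move=> r _ [a Aa [s ->]]; exists (r * a); first exact: AM.
    by exists (r * s); rewrite mulrDr mulrA.
  - exact: subAB.
  - by move=> m [a Aa [r e]]; apply: nz; exists m, a, r.
exists (fun x => `[< A x >]); split.
- split; first exact/asboolP.
    by move=> x y /asboolP Ax /asboolP Ay; apply/asboolP/AB.
  by move=> r x /asboolP Ax; apply/asboolP/AM.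
- move=> x y /asboolP Axy; apply/negPn/negP; rewrite negb_or.
  move=> /andP[/asboolP nAx /asboolP nAy].
  have [m [a [r [Aa ea]]]] := grow x nAx; have [m' [b [s [Ab eb]]]] := grow y nAy.
  apply: (Az (m + m')%N); rewrite exprD ea eb mulrDl.
  have Axs : A (r * x * (s * y)) by rewrite mulrACA; apply: (AM).
  have Aab : A (a * (b + s * y)) by rewrite mulrC; apply: (AM).
  apply: (AD _ _ Aab).
  by rewrite mulrDr; apply: (AD _ _ (AM _ _ Ab) Axs).
- exact/asboolP.
- by apply/negP => /asboolP Az1; apply: (Az 1%N); rewrite expr1.
Qed.

End PrimeAvoiding.

Section QuotientNat.
Variables (R : comNzRingType) (p : nat).
Hypothesis np1 : ~ divisible p (1 : R).

Definition multiples : {pred R} := fun x => `[< divisible p x >].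

Lemma multiples_idealr_closed : idealr_closed multiples.
Proof.
split; [exact/asboolP/divisible0 | exact/asboolP |].
move=> a x y /asboolP dx /asboolP dy; apply/asboolP.
by apply: divisibleD => //; apply: divisibleMl.
Qed.

HB.instance Definition _ := isIdealr.Build R multiples multiples_idealr_closed.

Lemma quotient_nat : exists (S : comNzRingType) (f : {rmorphism R -> S}),
  p%:R = 0 :> S /\ forall r, f r = 0 -> divisible p r.
Proof.
pose S := {ideal_quot multiples}; pose f : {rmorphism R -> S} := \pi_S%qT.
have kerf r : (f r == 0) = (r \in multiples).
  by rewrite -[r in RHS]subr0 Quotient.idealrBE -[0 in LHS](rmorph0 f).
exists S, f; split=> [|r /eqP].
  apply/eqP; rewrite -(rmorph_nat f) kerf; exact/asboolP/divisibleMn.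
by rewrite kerf => /asboolP.
Qed.

End QuotientNat.

(** * Finitely generated subrings and almost all primes *)

Section FinitelyGenerated.
Variable K : fieldType.
Hypothesis charK : [pchar K] =i pred0.
Implicit Types (A : subringClosed K) (c : K).

Definition int_pred : {pred K} := fun x => `[< exists m : int, x = m%:~R >].

Lemma int_pred_closed : subring_closed int_pred.
Proof.
split; first by apply/asboolP; exists 1.
  by move=> x y /asboolP[m ->] /asboolP[k ->]; apply/asboolP; exists (m - k); rewrite rmorphB.
by move=> x y /asboolP[m ->] /asboolP[k ->]; apply/asboolP; exists (m * k); rewrite rmorphM.
Qed.

HB.instance Definition _ := GRing.isSubringClosed.Build K int_pred int_pred_closed.

Definition adjoin A c : {pred K} :=
  fun x => `[< exists2 q : {poly K}, q \is a polyOver A & x = q.[c] >].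

Lemma adjoin_closed A c : subring_closed (adjoin A c).
Proof.
split; first by apply/asboolP; exists 1; rewrite ?rpred1 ?hornerC.
  move=> x y /asboolP[q Aq ->] /asboolP[r Ar ->]; apply/asboolP.
  by exists (q - r); rewrite ?rpredB // hornerD hornerN.
move=> x y /asboolP[q Aq ->] /asboolP[r Ar ->]; apply/asboolP.
by exists (q * r); rewrite ?rpredM // hornerM.
Qed.

HB.instance Definition _ A c :=
  GRing.isSubringClosed.Build K (adjoin A c) (adjoin_closed A c).

Fixpoint generated (s : seq K) : subringClosed K :=
  if s is c :: s' then adjoin (generated s') c else int_pred.

Lemma mem_adjoin A c x : x \in A -> x \in adjoin A c.
Proof. by move=> Ax; apply/asboolP; exists x%:P; rewrite ?polyOverC ?hornerC. Qed.

Lemma mem_generated s x : x \in s -> x \in generated s.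
Proof.
elim: s => //= c s IH; rewrite inE => /predU1P[->|/IH]; last exact: mem_adjoin.
by apply/asboolP; exists 'X; rewrite ?polyOverX ?hornerX.
Qed.

(** In other words, z is not nilpotent in A/pA for almost all p: a weak form of generic freeness
    over the integers, suited to adjoining one element at a time. *)
Definition prime_avoidance (A : {pred K}) := forall z, z \in A -> z != 0 ->
  exists N, forall p, prime p -> (N < p)%N ->
    forall m r, r \in A -> z ^+ m <> r *+ p.

Lemma prime_avoidance_int : prime_avoidance int_pred.
Proof.
move=> _ /asboolP[z ->] z0; exists `|z|%N => p p_pr ltp m _ /asboolP[r ->].
have intr0 (k : int) : (k%:~R == 0 :> K) = (k == 0).
  have /pcharf0P natr0 := charK.
  by case: k => k; rewrite ?NegzE ?rmorphN ?oppr_eq0 /= natr0.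
rewrite -rmorphXn -rmorphMn /= => /eqP; rewrite -subr_eq0 -rmorphB intr0 subr_eq0.
move/eqP => /(congr1 absz); rewrite abszX -mulr_natr abszM /= natz => e.
have : (p %| `|z| ^ m)%N by rewrite e dvdn_mull.
rewrite Euclid_dvdX // => /andP[/dvdn_leq h _]; move: ltp; rewrite ltnNge h //.
by rewrite absz_gt0; apply: contra z0 => /eqP ->.
Qed.

Lemma pseudo_div A (d g : {poly K}) :
    d \is a polyOver A -> g \is a polyOver A -> d != 0 ->
  exists k (q r : {poly K}), [/\ q \is a polyOver A, r \is a polyOver A,
    lead_coef d ^+ k *: g = q * d + r & (size r < size d)%N].
Proof.
move=> Ad Ag d0; have [m] := ubnP (size g); elim: m g Ag => // m IH g Ag ltg.
have [ltgd|ledg] := ltnP (size g) (size d).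
  by exists 0%N, 0, g; rewrite rpred0 expr0 scale1r mul0r add0r.
have Ald : lead_coef d \in A by rewrite lead_coefE; exact/polyOverP.
have Alg : lead_coef g \in A by rewrite lead_coefE; exact/polyOverP.
pose t : {poly K} := lead_coef g *: 'X^(size g - size d).
have At : t \is a polyOver A by rewrite polyOverZ ?rpredX ?polyOverX.
have Ag' : lead_coef d *: g - t * d \is a polyOver A.
  by apply: rpredB; [apply: polyOverZ | apply: rpredM].
have d_gt0 : (0 < size d)%N by rewrite size_poly_gt0.
have ltg' : (size (lead_coef d *: g - t * d)%R < m)%N.
  have g_gt0 : (0 < size g)%N by apply: leq_trans ledg.
  apply: leq_trans (ltg : (size g <= m)%N); rewrite -(prednK g_gt0) ltnS.
  apply/leq_sizeP => j lej; rewrite coefB coefZ -scalerAl coefZ coefXnM.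
  have [ej|nj] := eqVneq j (size g).-1.
    have -> : (j < size g - size d)%N = false by lia.
    have -> : (j - (size g - size d) = (size d).-1)%N by lia.
    by rewrite ej -!lead_coefE mulrC subrr.
  have lt_gj : (size g <= j)%N by rewrite -(prednK g_gt0) ltn_neqAle eq_sym nj.
  rewrite [g`_j]nth_default // mulr0.
  case: ifP => _; first by rewrite mulr0 subr0.
  have lt_dj : (size d <= j - (size g - size d))%N.
    by rewrite leq_subRL ?(leq_trans (leq_subr _ _)) // subnK.
  by rewrite nth_default // mulr0 subr0.
have [k [q [r [Aq Ar e ltr]]]] := IH _ Ag' ltg'.
exists k.+1, (q + lead_coef d ^+ k *: t), r; split=> //.
  by rewrite rpredD // polyOverZ // rpredX.
by rewrite exprSr -scalerA mulrDl -scalerAl addrAC -e scalerBr subrK.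
Qed.

Lemma ex_min_size (P : {poly K} -> Prop) :
  (exists q, P q) -> exists2 q, P q & forall q', P q' -> (size q <= size q')%N.
Proof.
move=> exP; have exn : exists n, `[< exists2 q, P q & size q = n >].
  by have [q Pq] := exP; exists (size q); apply/asboolP; exists q.
case: (ex_minnP exn) => n /asboolP[q Pq eq] minn; exists q => // q' Pq'.
by rewrite eq minn //; apply/asboolP; exists q'.
Qed.

Lemma horner_eq0_size1 (q : {poly K}) c : (size q <= 1)%N -> q.[c] = 0 -> q = 0.
Proof. by move=> /size1_polyC ->; rewrite hornerC => ->. Qed.

(** If c is transcendental over A, the leading coefficient of a polynomial representing z does the
    job. Otherwise z has a nonzero multiple b in A; a relation z^m = p s becomes b^m = p s', and
    reducing s' modulo a minimal annihilating polynomial [mu] of c turns it into a relation in A, at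
    the cost of a power of the leading coefficient of [mu]. *)
Lemma prime_avoidance_adjoin A c : prime_avoidance A -> prime_avoidance (adjoin A c).
Proof.
move=> avA _ /asboolP[g Ag ->] z0.
pose van (q : {poly K}) := [/\ q \is a polyOver A, q != 0 & q.[c] = 0].
have Alead (q : {poly K}) : q \is a polyOver A -> lead_coef q \in A.
  by move=> Aq; rewrite lead_coefE; apply/polyOverP.
have [alg|trans] := pselect (exists q, van q); last first.
  have g0 : g != 0 by apply: contraNneq z0 => ->; rewrite horner0.
  have [|N hN] := avA _ (Alead _ Ag); first by rewrite lead_coef_eq0.
  exists N => p p_pr ltp m _ /asboolP[h Ah ->] e.
  apply: (hN p p_pr ltp m h`_(size (g ^+ m)).-1); first exact/polyOverP.
  rewrite -lead_coef_exp -coefMn lead_coefE; congr (_ : {poly K})`_ _.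
  apply/eqP; rewrite -subr_eq0; apply/negPn/negP => n0; apply: trans.
  exists (g ^+ m - h *+ p); split=> //; first by rewrite rpredB ?rpredX ?rpredMn.
  by rewrite hornerD hornerN horner_exp e hornerMn subrr.
have [mu [Amu mu0 muc] min_mu] := ex_min_size alg.
have low q : q \is a polyOver A -> (size q < size mu)%N -> q.[c] = 0 -> q = 0.
  move=> Aq ltq qc; apply/eqP/negPn/negP => q0.
  by have := min_mu q (And3 Aq q0 qc); rewrite leqNgt ltq.
(* Polynomials whose value at c is a nonzero multiple of z; one of minimal size will be constant and
   give b. *)
pose mult (h : {poly K}) := [/\ h \is a polyOver A, h.[c] != 0 &
  exists2 y, y \in adjoin A c & h.[c] = g.[c] * y].
have exh : exists h, mult h.
  by exists g; split=> //; exists 1; rewrite ?mulr1 // rpred1.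
have [h [Ah hc [y Ay ey]] min_h] := ex_min_size exh.
have ev_adj (q : {poly K}) : q \is a polyOver A -> q.[c] \in adjoin A c.
  by move=> Aq; apply/asboolP; exists q.
have h0 : h != 0 by apply: contraNneq hc => ->; rewrite horner0.
have lt_hmu : (size h < size mu)%N.
  have [k [q [r [Aq Ar e ltr]]]] := pseudo_div Amu Ah mu0.
  have er : r.[c] = lead_coef mu ^+ k * h.[c].
    by rewrite -hornerZ e hornerD hornerM muc mulr0 add0r.
  apply: leq_ltn_trans ltr; apply: min_h; split=> //.
    by rewrite er mulf_neq0 // expf_neq0 // lead_coef_eq0.
  exists (y * lead_coef mu ^+ k).
    by rewrite rpredM // rpredX // mem_adjoin // Alead.
  by rewrite er ey mulrCA [_ * y]mulrC.
(* Otherwise divide [mu] by [h]. The remainder has a multiple of z as its value, so minimality of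
   [h] makes that value 0 and minimality of [mu] makes the remainder 0. The quotient then
   annihilates c and is smaller than [mu]. *)
have size_h : (size h <= 1)%N.
  rewrite leqNgt; apply/negP => h_gt1.
  have [k [q [r [Aq Ar e ltr]]]] := pseudo_div Ah Amu h0.
  have lmu : lead_coef h ^+ k *: mu != 0.
    by rewrite scaler_eq0 negb_or mu0 expf_neq0 // lead_coef_eq0.
  have er : r.[c] = - q.[c] * h.[c].
    have := congr1 (horner^~ c) e; rewrite hornerZ muc mulr0 hornerD hornerM.
    by move/esym/eqP; rewrite addrC addr_eq0 mulNr => /eqP.
  have r0 : r = 0.
    apply: low => //; first exact: ltn_trans lt_hmu.
    apply/eqP/negPn/negP => rc; have : mult r.
      split=> //; exists (- q.[c] * y); last by rewrite er ey mulrCA.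
      by rewrite rpredM // rpredN ev_adj.
    by move/min_h; rewrite leqNgt ltr.
  rewrite r0 addr0 in e; have q0 : q != 0.
    by apply: contraNneq lmu => q0; rewrite e q0 mul0r.
  have qc : q.[c] = 0.
    have /eqP := er; rewrite r0 horner0 eq_sym mulf_eq0 (negPf hc) orbF oppr_eq0.
    by move/eqP.
  have := min_mu q (And3 Aq q0 qc).
  have := congr1 (fun q : {poly K} => size q) e.
  rewrite size_scale ?expf_neq0 ?lead_coef_eq0 // size_mul //.
  move=> ->; rewrite -subn1 -addnBA ?(ltnW h_gt1) //; move: h_gt1.
  by case: (size h) => [|[|m]] // _; rewrite subn1 /= addnS ltnNge leq_addr.
have hE := size1_polyC size_h; set b := h`_0 in hE.
have bc : h.[c] = b by rewrite hE hornerC.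
have Ab : b \in A by apply/polyOverP.
have [||N hN] := avA (lead_coef mu * b); first by rewrite rpredM // Alead.
  by rewrite mulf_neq0 ?lead_coef_eq0 // -bc.
exists N => p p_pr ltp m s As e.
have : s * y ^+ m \in adjoin A c by rewrite rpredM // rpredX.
case/asboolP => g' Ag' eg'.
have [k [q [r [Aq Ar er ltr]]]] := pseudo_div Amu Ag' mu0.
have rc : lead_coef mu ^+ k * b ^+ m = r.[c] *+ p.
  have -> : r.[c] = lead_coef mu ^+ k * g'.[c].
    by rewrite -hornerZ er hornerD hornerM muc mulr0 add0r.
  by rewrite -eg' -bc ey exprMn e mulrnAl mulrnAr.
have mu_gt1 : (1 < size mu)%N.
  by rewrite ltnNge; apply: contra mu0 => le1; rewrite (horner_eq0_size1 le1 muc).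
have t0 : (lead_coef mu ^+ k * b ^+ m)%:P - r *+ p = 0.
  apply: low.
  - by rewrite rpredB ?rpredMn // polyOverC rpredM ?rpredX ?Alead.
  - rewrite (leq_ltn_trans (size_polyD _ _)) // gtn_max.
    rewrite (leq_ltn_trans (size_polyC_leq1 _)) // size_polyN.
    by apply: leq_ltn_trans ltr; rewrite -scaler_nat size_scale_leq.
  - by rewrite hornerD hornerN hornerC hornerMn rc subrr.
have {}rc : lead_coef mu ^+ k * b ^+ m = r`_0 *+ p.
  have := congr1 (fun q : {poly K} => q`_0) t0.
  by rewrite coefB coefC coefMn coef0 => /eqP; rewrite subr_eq0 => /eqP.
(* k depends on s and m, so no fixed power of the leading coefficient would do; the power k + m of
   the product [lead_coef mu * b] absorbs it. *)
apply: (hN p p_pr ltp (k + m)%N (lead_coef mu ^+ m * b ^+ k * r`_0)).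
  by rewrite !rpredM ?rpredX ?Alead //; apply/polyOverP.
by rewrite -mulrnAr -rc exprMn !exprD [b ^+ k * _]mulrC mulrACA mulrC.
Qed.

Lemma prime_avoidance_generated s : prime_avoidance (generated s).
Proof.
by elim: s => [|c s IH]; [exact: prime_avoidance_int | exact: prime_avoidance_adjoin].
Qed.

End FinitelyGenerated.

(** * The Weyl algebra in characteristic zero *)

Section CommL.
Variable R : comNzRingType.
Implicit Types P : wpoly R.

Lemma wLM P : wL R * P = inner_op P.
Proof. by rewrite [LHS]wmonE !mul1r. Qed.

Lemma wmon_wL (c : R) i j : wmon c i j * wL R = wmon c i j.+1.
Proof. by rewrite wmon_split -!mulrA -exprSr -wmon_split. Qed.

Lemma wcoef_commL P i j : wcoef (wL R * P - P * wL R) i j = wcoef P i.+1 j *+ i.+1.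
Proof.
apply: (@bipoly_ind _ _ (fun P : wpoly R => wcoef (wL R * P - P * wL R) i j)
  (fun P : wpoly R => wcoef P i.+1 j *+ i.+1)) => [A C|A C|c k l] /=.
- by rewrite -wcoefB mulrBl mulrBr !opprD addrACA.
- by rewrite wcoefB mulrnBl.
rewrite -/(wmon c k l) wmon_wL wLM /wmon inner_op_bimon addrK -/(wmon _ _ _).
rewrite -[bimon c k l]/(wmon c k l) !wcoef_mon; case: k => [|k] /=.
  by rewrite mulr0n !mul0rn.
rewrite eqSS; case: (i =P k) => [->|_]; last by rewrite !mulr0n !mul0rn.
by rewrite !mulr1n -!mulrnA mulnC.
Qed.

End CommL.

Section WevalInjective.
Variables (R : comNzRingType) (B : nzRingType) (phi : {rmorphism R -> B}).
Variables (u v : B).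
Hypotheses (phiu : forall c, GRing.comm (phi c) u)
  (phiv : forall c, GRing.comm (phi c) v) (vu1 : v * u - u * v = 1).
Hypotheses (phi_inj : forall c, phi c = 0 -> c = 0)
  (R_char0 : forall (c : R) n, c *+ n.+1 = 0 -> c = 0).

(** The simplicity argument for A_1: the kernel is stable under brackets with u and v, which
    differentiate symbols and lower the total degree. An element killed by both brackets is a
    constant in characteristic 0. *)
Lemma weval_eq0 P : weval phi u v P = 0 -> P = 0.
Proof.
have [N] : exists N, forall i j, (N <= i + j)%N -> wcoef P i j = 0.
  exists (size (P : {poly {poly R}}) + inner_bound P)%N => i j leN; rewrite /wcoef.
  have [lti|lei] := ltnP i (size (P : {poly {poly R}})).
    by rewrite nth_default // (leq_trans (inner_boundP _ _)) //; lia.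
  by rewrite [_`_i]nth_default // coef0.
elim: N P => [|N IH] P bndP P0; first by apply: wcoefP => i j; rewrite bndP // wcoef0.
have DX : P * wX R - wX R * P = 0.
  apply: IH => [i j leN|]; first by rewrite wcoef_commX bndP ?mul0rn // addnS.
  by rewrite wevalB !wevalM // P0 mulr0 mul0r subrr.
have DL : wL R * P - P * wL R = 0.
  apply: IH => [i j leN|]; first by rewrite wcoef_commL bndP ?mul0rn.
  by rewrite wevalB !wevalM // P0 mulr0 mul0r subrr.
have PE : P = wmon (wcoef P 0 0) 0 0.
  apply: wcoefP => i j; rewrite wcoef_mon; case: i => [|i]; last first.
    have := wcoef_commL P i j; rewrite DL wcoef0 => /esym/R_char0 ->.
    by rewrite mulr0n mul0rn.
  case: j => [|j]; first by rewrite !mulr1n.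
  have := wcoef_commX P 0 j; rewrite DX wcoef0 => /esym/R_char0 ->.
  by rewrite mulr0n.
rewrite PE weval_bimon !mulr1 in P0; rewrite PE (phi_inj P0).
by have [-> _ _ _] := subr_morphE (@wmonB R 0 0).
Qed.

End WevalInjective.

(** * The generators u and v of A_1(K) *)

Section WeylGenerators.
Import finmap monalg.

Variable K : fieldType.
Hypothesis charK : [pchar K] =i pred0.
Local Notation A := (weyl K).
Local Notation x := (weyl_x K).
Local Notation y := (weyl_y K).

Lemma natf_neq0_char0 n : n.+1%:R != 0 :> K.
Proof. by have /pcharf0P -> := charK. Qed.

Definition weyl_u : A := x + y.
Definition weyl_v : A := 2^-1 *: (y - x).

Lemma half_weyl_u : 2^-1 *: weyl_u - weyl_v = x /\ 2^-1 *: weyl_u + weyl_v = y.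
Proof.
have half2 (w : A) : 2^-1 *: (w + w) = w.
  by rewrite -mulr2n -scaler_nat scalerA mulVf ?scale1r // natf_neq0_char0.
rewrite /weyl_u /weyl_v -scalerBr -scalerDr; split.
  by rewrite opprB addrACA addrN addr0 half2.
by rewrite [x + y]addrC addrACA addrN addr0 half2.
Qed.

Lemma weyl_vu : weyl_v * weyl_u - weyl_u * weyl_v = 1.
Proof.
rewrite /weyl_u /weyl_v -scalerAl -scalerAr -scalerBr.
have yx : y * x = x * y + 1 by rewrite -(weyl_relation K) addrC subrK.
have -> : (y - x) * (x + y) = y * y - x * x + 1.
  apply/eqP; rewrite mulrBl !mulrDr yx subr_eq addrACA subrK addrC; apply/eqP.
  by rewrite [1 + _]addrC.
have -> : (x + y) * (y - x) = y * y - x * x - 1.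
  rewrite mulrDl !mulrBr yx opprD [X in _ + X = _]addrCA addrACA subrr add0r addrA.
  by rewrite [- _ + y * y]addrC.
rewrite opprB addrC addrA subrK -mulr2n -(scaler_nat 2 (1 : A)) scalerA mulVf ?scale1r //.
exact: natf_neq0_char0.
Qed.

Lemma exchangeB : {morph @exchange K : w t / w - t}.
Proof. by move=> w t; rewrite -scaleN1r addrC exchange_linear scaleN1r addrC. Qed.

Lemma exchangeZ c w : exchange (c *: w) = c *: exchange w :> A.
Proof.
have [e0 _ _ _] := subr_morphE exchangeB.
by rewrite -[c *: w]addr0 exchange_linear e0 addr0.
Qed.

Lemma exchangeX n w : exchange (w ^+ n) = exchange w ^+ n :> A.
Proof.
by elim: n => [|n IH]; rewrite ?expr0 ?exchange1 // exprSr exchangeM IH -exprS.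
Qed.

Lemma exchange_u : exchange weyl_u = weyl_u.
Proof.
have [_ _ eD _] := subr_morphE exchangeB.
by rewrite /weyl_u eD exchange_x exchange_y addrC.
Qed.

Lemma exchange_v : exchange weyl_v = - weyl_v.
Proof. by rewrite /weyl_v exchangeZ exchangeB exchange_x exchange_y -scalerN opprB. Qed.

Local Notation ev := (weval (in_alg A) weyl_u weyl_v).

Lemma in_alg_comm c (w : A) : GRing.comm (in_alg A c) w.
Proof. by rewrite /GRing.comm /= -scalerAl -scalerAr mul1r mulr1. Qed.

Lemma weval_weylM : {morph ev : P Q / P * Q}.
Proof. by apply: wevalM => *; [exact: in_alg_comm.. | exact: weyl_vu]. Qed.

Lemma weyl_generated (w : A) : exists P, ev P = w.
Proof.
pose im (t : A) := exists P, ev P = t.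
have imB s t : im s -> im t -> im (s - t).
  by move=> [P <-] [Q <-]; exists (P - Q); rewrite wevalB.
have im1 : im 1 by exists 1; rewrite weval1.
have imM s t : im s -> im t -> im (s * t).
  by move=> [P <-] [Q <-]; exists (P * Q); rewrite weval_weylM.
have imZ c s : im s -> im (c *: s).
  move=> ims; rewrite -[s]mul1r scalerAl; apply: imM => //.
  by exists (wmon c 0 0); rewrite weval_bimon !mulr1.
have im0 : im 0 by rewrite -(subrr 1); apply: imB.
have imD s t : im s -> im t -> im (s + t).
  by move=> ims imt; rewrite -[t]opprK; apply: (imB) => //; rewrite -sub0r; apply: (imB).
have imu : im weyl_u by exists (wX K); rewrite weval_bimon rmorph1 !mul1r mulr1.
have imv : im weyl_v by exists (wL K); rewrite weval_bimon rmorph1 !mul1r.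
have [xE yE] := half_weyl_u.
have imx : im x by rewrite -xE; apply: imB => //; apply: imZ.
have imy : im y by rewrite -yE; apply: imD => //; apply: imZ.
rewrite -[w]weyl_reprK; move: (repr w) => p.
rewrite [p]monalgE.
have piD := @weyl_piD K; have pi0 : weyl_pi 0 = 0 :> A.
  by have := @weyl_piB K 0 0; rewrite !subrr.
rewrite (big_morph _ piD pi0); apply: (big_ind im) => // m _.
have -> : << p@_m *g m >> = p@_m *: << m >> :> free_xy K.
  by rewrite -mul_malgC [RHS]malgM_def fgmulUU mulr1 mul1m.
rewrite weyl_piZ; apply: imZ; case: m => s; elim: s => [|b s IH].
  by rewrite (_ : << _ >> = 1) ?weyl_pi1 //; congr << _ >>; apply: val_inj; rewrite /= fm1.
have -> : << FMonom (b :: s) >> = << fmu b >> * << FMonom s >> :> free_xy K.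
  rewrite malgM_def fgmulUU mulr1; congr << _ >>.
  by apply: val_inj; rewrite /= fmM fmU.
rewrite weyl_piM; apply: imM => //; move: imx imy.
rewrite weyl_x.unlock weyl_y.unlock free_x.unlock free_y.unlock.
by case: (b).
Qed.

Lemma exchange_weval (R : comNzRingType) (phi : {rmorphism R -> A}) P :
    (forall c w, GRing.comm (phi c) w) -> (forall c, exchange (phi c) = phi c) ->
  exchange (weval phi weyl_u weyl_v P) = weval phi weyl_u weyl_v (wflip P).
Proof.
move=> phiC phi_ex; pose ev' := weval phi weyl_u weyl_v; rewrite -/ev' -/(ev' _).
have evB : {morph ev' : P Q / P - Q} := @wevalB _ _ phi weyl_u weyl_v.
have evM : {morph ev' : P Q / P * Q} by apply: wevalM => //; apply: weyl_vu.
have evX n : {morph ev' : P / P ^+ n} by move=> Q; apply: wevalX => //; apply: weyl_vu.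
have [_ evN _ _] := subr_morphE evB.
apply: (@bipoly_ind _ _ (fun P : wpoly R => exchange (ev' P))
  (fun P : wpoly R => ev' (wflip P))) => [B C|B C|c i j] /=.
- by rewrite evB exchangeB.
- by rewrite wflipB evB.
rewrite -/(wmon c i j) wflip_mon !evM !evX evN /ev' !weval_bimon rmorph1.
rewrite !exchangeM !exchangeX exchange_u exchange_v phi_ex.
by rewrite !mul1r !mulr1; apply/esym/phiC.
Qed.

End WeylGenerators.

(** * Descent to a subring and the degree of V in u *)

Section SubringType.
Variables (K : fieldType) (A : subringClosed K).

Definition subring_type := {c : K | c \in A}.

HB.instance Definition _ := SubChoice.on subring_type.
HB.instance Definition _ := [SubChoice_isSubComNzRing of subring_type by <:].

Definition subring_val : {rmorphism subring_type -> K} := val.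

Lemma subring_val_inj : injective subring_val. Proof. exact: val_inj. Qed.

End SubringType.

Section WevalMap.
Variables (R R' : comNzRingType) (B : nzRingType).
Variables (phi : {rmorphism R -> B}) (f : {rmorphism R' -> R}) (u v : B).

Lemma weval_map (P : wpoly R) (P' : wpoly R') :
    (forall i j, f (wcoef P' i j) = wcoef P i j) ->
  weval (phi \o f) u v P' = weval phi u v P.
Proof.
move=> eP; rewrite /weval.
pose n := maxn (size (P : {poly {poly R}})) (size (P' : {poly {poly R'}})).
pose m := maxn (inner_bound P) (inner_bound P').
rewrite (@bisum_widen _ _ _ P' n m) ?(@bisum_widen _ _ _ P n m) ?leq_maxl ?leq_maxr //.
- by apply: eq_bigr => i _; apply: eq_bigr => j _ /=; rewrite -/(wcoef P' i j) eP.
- by move=> i j; rewrite rmorph0 mul0r.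
- by move=> i; rewrite (leq_trans (inner_boundP _ _)) ?leq_maxl.
- by move=> i j; rewrite rmorph0 mul0r.
- by move=> i; rewrite (leq_trans (inner_boundP _ _)) ?leq_maxr.
Qed.

End WevalMap.

Section OuterDegree.
Variable K : fieldType.
Hypothesis charK : [pchar K] =i pred0.
Local Notation W := (wpoly K).
Local Notation M := {poly {poly K}}.

Definition wcoefs (P : W) : seq K := flatten [seq polyseq q | q <- polyseq (P : M)].

Lemma mem_wcoefs (A : subringClosed K) (P : W) :
  {subset wcoefs P <= A} -> forall i j, wcoef P i j \in A.
Proof.
move=> sub i j; rewrite /wcoef.
have [lti|lei] := ltnP i (size (P : M)); last first.
  by rewrite [(P : M)`_i]nth_default // coef0 rpred0.
have [ltj|lej] := ltnP j (size ((P : M)`_i)%R); last by rewrite nth_default // rpred0.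
apply: sub; apply/flattenP; exists (polyseq ((P : M)`_i)); last exact: mem_nth.
by apply/mapP; exists ((P : M)`_i) => //; apply: mem_nth.
Qed.

Lemma wpoly_lift (A : subringClosed K) (P : W) : (forall i j, wcoef P i j \in A) ->
  exists P' : wpoly (subring_type A),
    forall i j, subring_val A (wcoef P' i j) = wcoef P i j.
Proof.
move=> PA; pose lift (c : K) : subring_type A := insubd 0 c.
have lift0 : lift 0 = 0 by apply: val_inj; rewrite /lift val_insubd rpred0.
exists (map_poly (map_poly lift) (P : M)) => i j.
rewrite /wcoef coef_map_id0; last by rewrite map_poly0.
by rewrite coef_map_id0 // /lift [LHS]val_insubd PA.
Qed.

Lemma outer_degree0 (U V : weyl K) (P : W) :
    V * U - U * V = 1 -> exchange U = U -> exchange V = - V ->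
    weval (in_alg (weyl K)) (weyl_u K) (weyl_v K) P = V ->
  (size (P : M) <= 1)%N.
Proof.
move=> VU exU exV evP; have [P0 evP0] := weyl_generated charK U.
rewrite leqNgt; apply/negP => P_gt1.
pose k := (size (P : M)).-1; pose l := (size ((P : M)`_k)%R).-1.
pose z := wcoef P k l.
have Pk0 : (P : M)`_k != 0 by rewrite -lead_coefE lead_coef_eq0 -size_poly_gt0 ltnW.
have z0 : z != 0 by rewrite /z /wcoef -lead_coefE lead_coef_eq0.
pose A := generated (wcoefs P ++ wcoefs P0).
have PA : forall i j, wcoef P i j \in A.
  by apply: mem_wcoefs => c Pc; apply: mem_generated; rewrite mem_cat Pc.
have P0A : forall i j, wcoef P0 i j \in A.
  by apply: mem_wcoefs => c Pc; apply: mem_generated; rewrite mem_cat Pc orbT.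
have [V' eV] := wpoly_lift PA; have [U' eU] := wpoly_lift P0A.
have [N avN] := prime_avoidance_generated charK (PA k l) z0.
pose a := \max_(n <- [:: size (P : M); size (P0 : M); inner_bound P; inner_bound P0]) n.
(* p > N keeps z non-nilpotent modulo p, p > D^2 with D = a + 2 keeps the Jacobian factors outside
   Q, and p > 2 makes p odd. *)
have [p ltp p_pr] := prime_above (N + a.+2 * a.+2 + 2).
have p_odd : odd p by have := even_prime p_pr; lia.
case: p ltp p_pr p_odd => // n ltp p_pr p_odd.
set B := weyl K in V U VU exU exV evP evP0 *.
pose R : comNzRingType := subring_type A; pose val' : {rmorphism R -> K} := subring_val A.
pose phi := [the {rmorphism R -> B} of in_alg B \o val'].
pose ev := weval phi (weyl_u K) (weyl_v K).
have evV : ev V' = V by rewrite -evP; apply: weval_map.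
have evU : ev U' = U by rewrite -evP0; apply: weval_map.
have phiC c w : GRing.comm (phi c) w by apply: in_alg_comm.
have vu := weyl_vu charK.
have evM : {morph ev : S T / S * T} by apply: wevalM.
have evB : {morph ev : S T / S - T} by apply: wevalB.
have evX m : {morph ev : S / S ^+ m} by move=> S; apply: wevalX.
have phi_inj c : phi c = 0 -> c = 0.
  move=> /eqP; rewrite /= scaler_eq0 oner_eq0 orbF => /eqP c0.
  by apply: (@subring_val_inj _ A); rewrite [LHS]c0 rmorph0.
have natR (c : R) m : c *+ m.+1 = 0 -> c = 0.
  move/(congr1 val'); rewrite rmorphMn rmorph0 -mulr_natr => /eqP.
  rewrite mulf_eq0 (negPf (natf_neq0_char0 charK m)) orbF => /eqP c0.
  by apply: (@subring_val_inj _ A); rewrite [LHS]c0 rmorph0.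
have ev_eq0 S : ev S = 0 -> S = 0 by apply: weval_eq0.
(* Relations are verified in A_1(K) and pulled back to coefficients in R, where reduction modulo p
   makes sense, through injectivity of [ev]. *)
have VU' : V' * U' - U' * V' = 1.
  by apply/subr0_eq/ev_eq0; rewrite !evB !evM evV evU VU /ev weval1 subrr.
have ev_flip S : ev (wflip S) = exchange (ev S).
  apply/esym/exchange_weval => // c.
  by rewrite /= exchangeZ exchange1.
have flipU : wflip (U' ^+ n.+1) = U' ^+ n.+1.
  by apply/subr0_eq/ev_eq0; rewrite evB ev_flip evX evU exchangeX exU subrr.
have flipV : wflip (V' ^+ n.+1) = - V' ^+ n.+1.
  apply/subr0_eq/ev_eq0; have [_ evN _ _] := subr_morphE evB.
  rewrite evB evN ev_flip evX evV exchangeX exV exprNn -signr_odd p_odd.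
  by rewrite mulN1r subrr.
have size_le (S : wpoly R) (S0 : W) m :
    (forall i j, val' (wcoef S i j) = wcoef S0 i j) -> (size (S0 : M) <= m)%N ->
    (size (S : {poly {poly R}}) <= m)%N.
  move=> eS leS; apply/leq_sizeP => i lei; apply/polyP => j.
  apply: (@subring_val_inj _ A); rewrite coef0 rmorph0.
  by rewrite [LHS]eS /wcoef [_`_i]nth_default ?coef0 // (leq_trans leS).
have inner_size_le (S : wpoly R) (S0 : W) m i :
    (forall i j, val' (wcoef S i j) = wcoef S0 i j) ->
    (size ((S0 : M)`_i)%R <= m)%N -> (size ((S : {poly {poly R}})`_i)%R <= m)%N.
  move=> eS leS; apply/leq_sizeP => j lej; apply: (@subring_val_inj _ A).
  by rewrite rmorph0 [LHS]eS /wcoef nth_default // (leq_trans leS).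
have le_a m : m \in [:: size (P : M); size (P0 : M); inner_bound P; inner_bound P0] ->
    (m <= a.+1)%N.
  by move=> am; rewrite (leq_trans _ (leqnSn a)) // /a; apply: leq_bigmax_seq.
have sU : (size (U' : {poly {poly R}}) <= a.+1)%N.
  by apply: size_le eU _; rewrite le_a // !inE eqxx orbT.
have sV : (size (V' : {poly {poly R}}) <= a.+1)%N.
  by apply: size_le eV _; rewrite le_a // !inE eqxx.
have iU : inner_le a U'.
  move=> i; apply: inner_size_le eU _; rewrite (leq_trans (inner_boundP _ _)) //.
  by rewrite le_a // !inE eqxx !orbT.
have iV : inner_le a V'.
  move=> i; apply: inner_size_le eV _; rewrite (leq_trans (inner_boundP _ _)) //.
  by rewrite le_a // !inE eqxx !orbT.
pose z' := wcoef V' k l.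
have nz m : ~ divisible n.+1 (z' ^+ m).
  case=> r /(congr1 val'); rewrite rmorphXn rmorphMn eV => e.
  by apply: (avN n.+1 p_pr _ m (val' r)) e; [lia | exact: valP].
(* The exponent 0 says that 1 is not in pR, so the quotient R/pR is nontrivial. *)
have [S [f [charS kerf]]] := quotient_nat (nz 0%N).
have [Q [[Q0 QB QM] Qprime Qp nQz]] := prime_ideal_avoiding nz.
have Q1 : 1 \notin Q by apply: contra nQz => Q1; rewrite -[z']mulr1 QM.
have p_reg (r : R) : r *+ n.+1 = 0 -> r = 0 by apply: natR.
have := @modular_step R S n f p_pr p_odd charS kerf p_reg Q Q0 QB QM Qprime Q1 Qp
  U' V' a VU' sU sV iU iV flipU flipV.
move=> /(_ _ k l) h; move/negP: nQz; apply; apply: h; first by lia.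
- by rewrite /k -subn1 subn_gt0.
- by apply: size_le eV _; rewrite /k prednK // ltnW.
- by apply: inner_size_le eV _; rewrite /l prednK // size_poly_gt0.
Qed.

End OuterDegree.

(** * Elements of degree 0 in u and their commutators *)

Section InnerPolynomial.
Variable R : comNzRingType.
Local Notation W := (wpoly R).
Local Notation M := {poly {poly R}}.
Implicit Types (g h : {poly R}) (P Q : W).

(** The element g(v). *)
Definition winner g : W := g%:P.

Lemma winner_sum g : winner g = \sum_(j < size g) wmon g`_j 0 j.
Proof.
have [->|g0] := eqVneq g 0; first by rewrite size_poly0 big_ord0 /winner polyC0.
rewrite [LHS](wpoly_sum) /winner size_polyC g0 big_ord1 /= coefC eqxx.
by apply: eq_bigr => j _; rewrite /wcoef coefC eqxx.
Qed.

Lemma coef_iter_inner_op2 Q j b : (size (Q : M) <= b.+2)%N ->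
  (iter j (@inner_op R) Q)`_b
  = 'X^j * (Q : M)`_b + ('X^j)^`() * (Q : M)`_b.+1 *+ b.+1.
Proof.
move=> leQ; elim: j => [|j IH]; first by rewrite mul1r derivC mul0r mul0rn addr0.
rewrite iterS coef_inner_op coef_iter_inner_op // IH exprS derivM derivX mul1r.
by rewrite mulrDr mulrDl mulrnDl !mulrnAr !mulrA addrCA.
Qed.

(** g(v) u^(b+1) = u^(b+1) g(v) + (b+1) u^b g'(v) + lower powers of u, so under the size bound only
    two coefficients of Q contribute. *)
Lemma coef_winner_mul g Q b : (size (Q : M) <= b.+2)%N ->
  (winner g * Q : M)`_b = g * (Q : M)`_b + g^`() * (Q : M)`_b.+1 *+ b.+1.
Proof.
move=> leQ; rewrite winner_sum mulr_suml coef_sum.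
under eq_bigr do rewrite wmonE mul1r coefCM coef_iter_inner_op2 //.
have gE : g = \sum_(j < size g) g`_j *: 'X^j by rewrite -poly_def coefK.
rewrite [in RHS]gE raddf_sum !mulr_suml -sumrMnl -big_split /=.
by apply: eq_bigr => j _; rewrite derivZ -!mul_polyC mulrDr mulrnAr !mulrA.
Qed.

Lemma mul_winner g Q : (Q * winner g : M) = (Q : M) * g%:P.
Proof.
apply: (@bipoly_ind _ _ (fun Q : W => Q * winner g) (fun Q : M => Q * g%:P)).
- by move=> A B; rewrite mulrBl.
- by move=> A B; rewrite mulrBl.
move=> c i j; rewrite [LHS]wmonE.
have -> : iter j (@inner_op R) (winner g) = ('X^j * g)%:P.
  elim: j => [|j IH]; first by rewrite mul1r.
  by rewrite iterS IH /inner_op derivC add0r -polyCM mulrA -exprS.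
by rewrite /bimon [_%:P * 'X^i]mulrC -mulrA -polyCM -mul_polyC mulrCA -polyCM mulrA.
Qed.

Lemma coef_comm_winner g Q b : (size (Q : M) <= b.+2)%N ->
  (winner g * Q - Q * winner g : M)`_b = g^`() * (Q : M)`_b.+1 *+ b.+1.
Proof.
by move=> leQ; rewrite coefB coef_winner_mul // mul_winner coefMC mulrC addrC addKr.
Qed.

End InnerPolynomial.

Section Shape.
Variable K : fieldType.
Hypothesis charK : [pchar K] =i pred0.
Local Notation W := (wpoly K).
Local Notation M := {poly {poly K}}.

Lemma deriv_eq0_size (g : {poly K}) : g^`() = 0 -> (size g <= 1)%N.
Proof.
move=> g'0; apply/leq_sizeP => -[|j] // _.
have /eqP := congr1 (fun q : {poly K} => q`_j) g'0.
by rewrite coef_deriv coef0 -mulr_natr mulf_eq0 (negPf (natf_neq0_char0 charK j)) orbF => /eqP.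
Qed.

Lemma winner_comm_shape (g : {poly K}) (Q : W) : winner g * Q - Q * winner g = 1 ->
  exists (c g0 : K) (h : {poly K}), [/\ c != 0, winner g = wmon g0 0 0 + wmon c 0 1
    & Q = wmon c^-1 1 0 + winner h].
Proof.
move=> gQ1.
have coefb b : (size (Q : M) <= b.+2)%N ->
    g^`() * (Q : M)`_b.+1 *+ b.+1 = (b == 0)%N%:R.
  by move=> leQ; rewrite -coef_comm_winner // gQ1 wone_poly coef1.
have g'0 : g^`() != 0.
  apply/eqP => /deriv_eq0_size/size1_polyC gE; move/eqP: gQ1; rewrite gE.
  have -> : winner (g`_0)%:P = wmon g`_0 0 0 :> W.
    by rewrite /wmon /bimon mulr1 -mul_polyC mulr1.
  by rewrite wmonC subrr eq_sym oner_eq0.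
have sQ : (size (Q : M) <= 2)%N.
  rewrite leqNgt; apply/negP => sQ; have := coefb (size (Q : M)).-2.
  have -> : ((size (Q : M)).-2.+2 = size (Q : M))%N by case: size sQ => [|[|?]].
  have -> : ((size (Q : M)).-2.+1 = (size (Q : M)).-1)%N by case: size sQ => [|[|?]].
  have -> : ((size (Q : M)).-2 == 0)%N = false by case: size sQ => [|[|[|?]]].
  move=> /(_ (leqnn _)) /eqP; rewrite -lead_coefE -scaler_nat scaler_eq0 mulf_eq0.
  rewrite (negPf g'0) lead_coef_eq0 -size_poly_eq0; case: (size _) sQ => [|[|[|m]]] // _.
  by rewrite orbF (negPf (natf_neq0_char0 charK _)).
have := coefb 0%N sQ; rewrite mulr1n /= => g'Q1.
have /andP[/size_poly1P[c c0 eg'] /size_poly1P[d d0 eQ1]] :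
    (size g^`() == 1)%N && (size ((Q : M)`_1)%R == 1)%N.
  by rewrite -size_mul_eq1 g'Q1 size_poly1.
have cd : c * d = 1.
  by have /eqP := g'Q1; rewrite eg' eQ1 -polyCM -polyC1 => /eqP/polyC_inj.
have {}cd : c^-1 = d by rewrite -[LHS]mulr1 -cd mulKf.
exists c, g`_0, (Q : M)`_0; split=> //.
- have : (g - c *: 'X)^`() = 0 by rewrite derivB derivZ derivX eg' alg_polyC subrr.
  move=> /deriv_eq0_size/size1_polyC; rewrite coefB coefZ coefX mulr0 subr0.
  move=> /eqP; rewrite subr_eq => /eqP ->; rewrite coefD coefC coefZ coefX /= mulr0 addr0.
  by rewrite /winner /wmon /bimon !mulr1 polyCD -[in RHS]mul_polyC mulr1.
apply/polyP => i; rewrite coefD /wmon /bimon coefMX coefC /winner coefC.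
case: i => [|[|i]] /=; first by rewrite add0r.
  by rewrite addr0 cd eQ1 -mul_polyC mulr1.
by rewrite nth_default ?addr0 // (leq_trans sQ).
Qed.

Lemma sum_even_odd (Z : zmodType) (F : nat -> Z) m : (forall j, F j.*2.+1 = 0) ->
  \sum_(i < m.*2) F i = \sum_(j < m) F j.*2.
Proof.
move=> Fodd; elim: m => [|m IH]; first by rewrite !big_ord0.
by rewrite doubleS !big_ord_recr /= IH Fodd addr0.
Qed.

End Shape.

(** * The images of u and v, and the conclusion *)

Section AlphaEndomorphism.
Variable K : fieldType.
Hypothesis charK : [pchar K] =i pred0.
Local Notation A := (weyl K).
Local Notation W := (wpoly K).
Local Notation u := (weyl_u K).
Local Notation v := (weyl_v K).
Local Notation ev := (weval (in_alg A) u v).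

Lemma weval_winner (h : {poly K}) :
  ev (winner h) = \sum_(j < size h) h`_j *: v ^+ j.
Proof.
have [ev0 _ evD _] := subr_morphE (@wevalB _ _ (in_alg A) u v).
rewrite winner_sum (big_morph _ evD ev0); apply: eq_bigr => j _.
by rewrite weval_bimon /= mul1r -scalerAl mul1r.
Qed.

Lemma weyl_eq0 P : ev P = 0 -> P = 0.
Proof.
apply: weval_eq0; try by move=> c; apply: in_alg_comm.
- exact: weyl_vu.
- by move=> c /eqP; rewrite /= scaler_eq0 oner_eq0 orbF => /eqP.
- move=> c n /eqP; rewrite -mulr_natr mulf_eq0 (negPf (natf_neq0_char0 charK n)) orbF.
  by move/eqP.
Qed.

Lemma char0_double (V : lmodType K) (w : V) : w *+ 2 = 0 -> w = 0.
Proof.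
move/eqP; rewrite -(scaler_nat 2 w) scaler_eq0 (negPf (natf_neq0_char0 charK 1)).
by move/eqP.
Qed.

Lemma symmetric_pair_shape (U V : A) :
    V * U - U * V = 1 -> exchange U = U -> exchange V = - V ->
  exists c (h : {poly K}), [/\ c != 0, V = c *: v,
    U = c^-1 *: u + \sum_(j < size h) h`_j *: v ^+ j & forall j, odd j -> h`_j = 0].
Proof.
move=> VU exU exV.
have [P evP] := weyl_generated charK V; have [Q evQ] := weyl_generated charK U.
have [ev0 evN evD _] := subr_morphE (@wevalB _ _ (in_alg A) u v).
have sP := outer_degree0 charK VU exU exV evP.
have PE : P = winner (P : {poly {poly K}})`_0 by apply: size1_polyC.
set g := _`_0 in PE.
have PQ1 : winner g * Q - Q * winner g = 1.
  apply/subr0_eq/weyl_eq0; rewrite !wevalB !weval_weylM // weval1 -PE evP evQ.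
  by rewrite VU subrr.
have [c [g0 [h [c0 eg eQ]]]] := winner_comm_shape charK PQ1.
have VE : V = g0%:A + c *: v.
  by rewrite -evP PE eg evD !weval_bimon /= !mul1r !mulr1 -scalerAl mul1r.
have UE : U = c^-1 *: u + \sum_(j < size h) h`_j *: v ^+ j.
  by rewrite -evQ eQ evD weval_winner weval_bimon /= mulr1 -scalerAl mul1r.
have [_ _ exD _] := subr_morphE (@exchangeB K).
(* The constant term is fixed by the exchange while V is negated, so it equals its own opposite. *)
have g00 : g0%:A = 0 :> A.
  apply: char0_double; rewrite mulr2n; move: exV; rewrite VE exD exchangeZ exchange1.
  rewrite exchangeZ exchange_v scalerN opprD => /addIr /eqP.
  by rewrite -subr_eq0 opprK => /eqP.
exists c, h; split=> //; first by rewrite VE g00 add0r.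
(* [F] collects the symbol of h(v) - h(-v), which vanishes because U is symmetric. *)
move=> j oj; pose F i := wmon (h`_i - (-1) ^+ i * h`_i) 0 i.
have F0 : \sum_(i < size h) F i = 0 :> W.
  apply: weyl_eq0; rewrite (big_morph _ evD ev0).
  have := exU; rewrite UE exD exchangeZ exchange_u => /addrI.
  rewrite (big_morph _ exD (_ : exchange 0 = 0)); last first.
    by have [] := subr_morphE (@exchangeB K).
  move/esym/eqP; rewrite -subr_eq0 -sumrB => /eqP e; rewrite -[RHS]e.
  apply: eq_bigr => i _; rewrite weval_bimon /= mul1r -scalerAl mul1r.
  rewrite exchangeZ exchangeX exchange_v (exprNn v) -(signr_odd K) -(signr_odd A).
  by case: odd; rewrite ?mulN1r ?mul1r ?scalerN ?scalerBl ?scaleNr ?opprK //.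
have [ltj|lej] := ltnP j (size h); last by rewrite nth_default.
have := congr1 (fun S : W => wcoef S 0 j) F0; rewrite wcoef_sum wcoef0.
rewrite (bigD1 (Ordinal ltj)) //= wcoef_mon !eqxx big1 ?addr0; last first.
  move=> i; rewrite -val_eqE /= eq_sym => /negPf nij.
  by rewrite wcoef_mon nij mulr0n.
rewrite !mulr1n -signr_odd oj mulN1r opprK -mulr2n.
exact: (@char0_double K^o).
Qed.

End AlphaEndomorphism.

Theorem corollary2p8 (K : fieldType) (charK : [pchar K] =i pred0)
    (f : {lrmorphism weyl K -> weyl K}) (f_alpha : alpha_endomorphism f) :
  alpha_automorphism f /\
  exists (n : nat) (a b : K) (c : 'I_n.+1 -> K),
    let x := weyl_x K in
    let y := weyl_y K in
    [/\ a ^+ 2 - b ^+ 2 = 1,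
        f x = a *: x + b *: y + \sum_(j < n.+1) c j *: (x - y) ^+ (2 * j)%N
      & f y = a *: y + b *: x + \sum_(j < n.+1) c j *: (x - y) ^+ (2 * j)%N].
Proof.
set A := weyl K.
pose u := weyl_u K; pose v := weyl_v K.
have vu : v * u - u * v = 1 := weyl_vu charK.
have [c [h [c0 fv fu h_odd]]] : exists c (h : {poly K}), [/\ c != 0, f v = c *: v,
    f u = c^-1 *: u + \sum_(j < size h) h`_j *: v ^+ j & forall j, odd j -> h`_j = 0].
  apply: symmetric_pair_shape => //.
  - by rewrite -!rmorphM -rmorphB vu rmorph1.
  - by rewrite -f_alpha exchange_u.
  - by rewrite -f_alpha exchange_v rmorphN.
set H := \sum_(j < size h) _ in fu.
have [xE yE] := half_weyl_u charK.
have f_weval (s t : A) P : f (weval (in_alg A) s t P) = weval (in_alg A) (f s) (f t) P.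
  apply: (@bipoly_ind _ _ (fun P : wpoly K => f (weval (in_alg A) s t P))
    (weval (in_alg A) (f s) (f t))) => [S T|S T|e i j] /=.
  - by rewrite wevalB rmorphB.
  - by rewrite wevalB.
  by rewrite !weval_bimon !rmorphM !rmorphXn /= linearZ rmorph1.
(* f turns evaluation at (u, v) into evaluation at (f u, f v). This pair satisfies the same
   relation, so that evaluation is injective too. *)
have f_eq0 w : f w = 0 -> w = 0.
  have [P <-] := weyl_generated charK w; rewrite f_weval => fP.
  suff -> : P = 0 by have [-> _ _ _] := subr_morphE (@wevalB _ _ (in_alg A) u v).
  apply: weval_eq0 fP; try by move=> e; apply: in_alg_comm.
  - by rewrite -!rmorphM -rmorphB vu rmorph1.
  - by move=> e /eqP; rewrite /= scaler_eq0 oner_eq0 orbF => /eqP.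
  move=> e n /eqP; rewrite -mulr_natr mulf_eq0 (negPf (natf_neq0_char0 charK n)) orbF.
  by move/eqP.
have f_surj w : exists t, f t = w.
  have [P <-] := weyl_generated charK w.
  (* Solving f(v) = c v and f(u) = u/c + h(v) for preimages of v and u, using f(h(v0)) = h(v). *)
  pose v0 := c^-1 *: v; pose u0 := c *: (u - \sum_(j < size h) h`_j *: v0 ^+ j).
  have fv0 : f v0 = v by rewrite linearZ /= fv scalerA mulVf // scale1r.
  have fu0 : f u0 = u.
    rewrite linearZ linearB /= fu linear_sum (eq_bigr (fun j : 'I_(size h) =>
      h`_j *: v ^+ j)) => [|j _]; last by rewrite linearZ /= rmorphXn /= fv0.
    by rewrite addrK scalerA mulfV // scale1r.
  by exists (weval (in_alg A) u0 v0 P); rewrite f_weval fu0 fv0.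
split.
  split=> //; pose g w := sval (cid (f_surj w)).
  have fK w : f (g w) = w by rewrite /g; case: cid.
  by exists g => // w; apply/subr0_eq/f_eq0; rewrite rmorphB /= fK subrr.
pose d : K := 2^-1.
have d2 : d * 2 = 1 by rewrite mulVf // natf_neq0_char0.
(* Since x = u/2 - v, f(x) = u/(2c) - c v + h(v)/2; expanding u = x + y and v = (y - x)/2 gives a
   and b, and a^2 - b^2 = 4 d^2 = 1. The factor d^(2j) comes from v^(2j) = d^(2j) (x - y)^(2j). The
   bound [size h] is generous: coefficients of h beyond its size are 0. *)
exists (size h), (d * (c^-1 + c)), (d * (c^-1 - c)).
exists (fun j => d * (h`_(2 * j)%N * (d ^+ (2 * j)%N))).
move=> x y.
have HE : \sum_(j < (size h).+1) (d * (h`_(2 * j)%N * d ^+ (2 * j)%N)) *: (x - y) ^+ (2 * j)%N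
    = d *: H.
  pose F j := h`_j *: v ^+ j.
  have -> : H = \sum_(j < (size h).+1) F j.*2.
    rewrite -(@sum_even_odd _ F) => [|j]; last by rewrite /F h_odd ?scale0r //= odd_double.
    rewrite /H (big_ord_widen (size h).+1.*2 F); last by rewrite -addnn; lia.
    rewrite big_mkcond /=; apply: eq_bigr => i _; case: ltnP => // lei.
    by rewrite /F nth_default // scale0r.
  rewrite scaler_sumr; apply: eq_bigr => j _; rewrite /F -mul2n -!scalerA.
  congr (_ *: (_ *: _)); rewrite /v /weyl_v exprZn; congr (_ *: _).
  by rewrite !exprM -[y - x]opprB sqrrN.
split; rewrite ?HE.
- rewrite [LHS](_ : _ = (d * 2) ^+ 2 * (c^-1 * c)); last by ring.
  by rewrite d2 mulVf // expr1n mulr1.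
- have -> : f x = d *: f u - f v by rewrite -linearZ -linearB /= xE.
  rewrite fu fv scalerDr addrAC; congr (_ + _).
  rewrite /u /weyl_u /v /weyl_v !scalerA scalerBr scalerDr opprB addrACA.
  by rewrite -scalerDl -scalerBl [c * _]mulrC -mulrDr -mulrBr.
- have -> : f y = d *: f u + f v by rewrite -linearZ -linearD /= yE.
  rewrite fu fv scalerDr addrAC; congr (_ + _).
  rewrite /u /weyl_u /v /weyl_v !scalerA scalerBr scalerDr [X in X + _]addrC addrACA.
  by rewrite -scalerDl -scalerBl [c * _]mulrC -mulrDr -mulrBr.
Qed.
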